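(* For every $w\in F$ the nested traversal normal form $\eta(w)$ is a $(\lambda,\epsilon)$-quasigeodesic with $\lambda=6$ and $\epsilon=0$, with respect to the generating set $A=\{x_0^{\pm1},x_1^{\pm1}\}$.
   Context: A word $y$ over $A$ is a $(\lambda,\epsilon)$-quasigeodesic if the unit-speed path $p:[0,l(y)]\to\Gamma(F,A)$ labelled by $y$ satisfies $\frac1\lambda|s-t|-\epsilon\le d_A(p(s),p(t))\le\lambda|s-t|+\epsilon$ for all $s,t\in[0,l(y)]$, where $d_A$ is the word metric and $\Gamma(F,A)$ the Cayley graph. $F$ is Thompson's group with generators $x_0,x_1$. Elements are represented by tree pair diagrams $(T_-,T_+)$ of finite rooted binary trees with equally many carets (a caret is a vertex with its two downward edges); carets are numbered in infix order starting at $1$; leaves are numbered left to right from $0$. A diagram is reduced if no pair of carets, one in each tree, both have two leaves with the same leaf numbers; each element has a unique reduced diagram $(T_-(w),T_+(w))$ with $N(w)$ carets per tree. A caret is a right (left) caret if one of its edges lies on the right (left) side of the tree; the root is both; others are interior. The infinite normal form is $w=w_pw_n$ ($w_p$ positive, $w_n$ negative part); $w_n$ is represented by $(T_-(w),R_{N(w)})$ and $w_p^{-1}$ by $(T_+(w),R_{N(w)})$, $R_k$ the tree of $k$ right carets. Nested traversal word $\gamma(T)$ of a tree $T$: go through the carets of $T$ in infix order, skipping carets in the right subtree of a caret to which rule (3) or (5) has already been applied, and append: (1) nothing for the caret with infix number 1; (2) $x_0^{-1}$ for a left caret with infix number $>1$; (3) $x_0^{-1}\gamma(T')x_0x_1^{-1}$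 for an interior caret with nonempty right subtree $T'$ ($T'$ regarded as a tree in its own right); (4) $x_1^{-1}$ for an interior caret with empty right subtree; (5) $x_0^{-1}\gamma(T')x_0$ for a non-root right caret whose right subtree $T'$ contains an interior caret; (6) nothing for a non-root right caret whose right subtree contains no interior caret. Set $\eta(w_n)=\gamma(T_-(w))$, $\eta(w_p)=\gamma(T_+(w))^{-1}$, and let $\eta(w)$ be the free reduction of $\eta(w_p)\eta(w_n)$.
   Formalization: In rules (3) and (5) the carets of T' keep the type (right or interior) and infix numbering they have in T, instead of T' being regarded as a tree in its own right; otherwise η(w) need not represent w and the claim with λ=6 fails. *)

(* Defs.v *)
From Stdlib Require Import Reals List Bool ZArith ClassicalEpsilon.
Import ListNotations.
Open Scope R_scope.

Inductive gen := X0 | X1.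
Definition gen_eqb (a b : gen) : bool :=
  match a, b with X0, X0 | X1, X1 => true | _, _ => false end.

(* a letter (a, e): e = false means x_a, e = true means x_a^{-1} *)
Definition letter := (gen * bool)%type.
Definition word := list letter.

Definition inv_letter (l : letter) : letter := (fst l, negb (snd l)).
Definition inv_word (w : word) : word := rev (map inv_letter w).

Definition letter_eqb (l m : letter) : bool :=
  gen_eqb (fst l) (fst m) && Bool.eqb (snd l) (snd m).

Definition freduce (w : word) : word :=
  fold_right (fun l acc =>
    match acc with
    | h :: t => if letter_eqb h (inv_letter l) then t else l :: acc
    | [] => [l]
    end) [] w.

(** * Thompson's group F as a group of PL homeomorphisms of [0,1]
    (Cannon-Floyd-Parry model; extended by the identity outside [0,1]). *)
Definition outside (t : R) : bool :=
  if Rlt_dec t 0 then true else if Rlt_dec 1 t then true else false.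

Definition fx0 (t : R) : R :=
  if outside t then t else
  if Rle_dec t (1/2) then t / 2 else
  if Rle_dec t (3/4) then t - 1/4 else 2 * t - 1.
Definition fx0inv (t : R) : R :=
  if outside t then t else
  if Rle_dec t (1/4) then 2 * t else
  if Rle_dec t (1/2) then t + 1/4 else (t + 1) / 2.
Definition fx1 (t : R) : R :=
  if outside t then t else
  if Rle_dec t (1/2) then t else
  if Rle_dec t (3/4) then t / 2 + 1/4 else
  if Rle_dec t (7/8) then t - 1/8 else 2 * t - 1.
Definition fx1inv (t : R) : R :=
  if outside t then t else
  if Rle_dec t (1/2) then t else
  if Rle_dec t (5/8) then 2 * t - 1/2 else
  if Rle_dec t (3/4) then t + 1/8 else (t + 1) / 2.

Definition letter_fun (l : letter) : R -> R :=
  match l with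
  | (X0, false) => fx0 | (X0, true) => fx0inv
  | (X1, false) => fx1 | (X1, true) => fx1inv
  end.

(* the group element of a word; the product g*h is the composition g o h *)
Fixpoint eval (w : word) : R -> R :=
  match w with
  | [] => fun t => t
  | l :: u => fun t => letter_fun l (eval u t)
  end.

Inductive tree := Leaf | Node (l r : tree).

Fixpoint ncarets (T : tree) : nat :=
  match T with Leaf => 0%nat | Node l r => S (ncarets l + ncarets r) end.
Definition nleaves (T : tree) : nat := S (ncarets T).

Fixpoint leaf_intervals (T : tree) (a b : R) : list (R * R) :=
  match T with
  | Leaf => [(a, b)]
  | Node l r => leaf_intervals l a ((a + b) / 2) ++ leaf_intervals r ((a + b) / 2) b
  end.

(* The element represented by the tree pair diagram (Tm, Tp): the PL map
   sending the i-th leaf interval of Tm affinely onto the i-th leaf interval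
   of Tp (identity outside [0,1]).  With this convention positive elements
   are those with Tm = R_n (e.g. x0 = (R_2, left-heavy tree)). *)
Fixpoint pl_apply (ps : list ((R * R) * (R * R))) (t : R) : R :=
  match ps with
  | [] => t
  | ((a, b), (c, d)) :: ps' =>
      if Rle_dec a t then if Rle_dec t b then c + (t - a) * (d - c) / (b - a)
                          else pl_apply ps' t
      else pl_apply ps' t
  end.

Definition diagram_fun (Tm Tp : tree) : R -> R :=
  fun t => if outside t then t else
    pl_apply (combine (leaf_intervals Tm 0 1) (leaf_intervals Tp 0 1)) t.

Fixpoint exposed (T : tree) (k : nat) : list nat :=
  match T with
  | Leaf => []
  | Node Leaf Leaf => [k]
  | Node l r => exposed l k ++ exposed r (k + nleaves l)%nat
  end.

Definition reduced (Tm Tp : tree) : Prop :=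
  forall i, In i (exposed Tm 0) -> In i (exposed Tp 0) -> False.

(* r has only right carets (as a subtree hanging on the right side),
   i.e. contains no interior caret *)
Fixpoint right_spine (T : tree) : bool :=
  match T with
  | Leaf => true
  | Node Leaf r => right_spine r
  | Node _ _ => false
  end.

Definition isLeaf (T : tree) : bool := match T with Leaf => true | _ => false end.

Definition x0 : letter := (X0, false).
Definition x0i : letter := (X0, true).
Definition x1i : letter := (X1, true).

(* Nested calls gamma(T') (rules 3, 5) traverse T' keeping the caret types
   (left/right/interior) that its carets have in the ambient tree T.  Inside T' rules 1 and 2 can never fire.
   trav T onL onR off: the contribution of the carets of the subtree T,
   whose root lies on the left side (onL) / right side (onR) of the ambient
   tree, and which is preceded by [off] carets in infix order. *)
Fixpoint trav (T : tree) (onL onR : bool) (off : nat) : word :=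
  match T with
  | Leaf => []
  | Node l r =>
      let n := (off + ncarets l + 1)%nat in
      trav l onL false off ++
      (if Nat.eqb n 1 then trav r false onR n                       (* rule 1 *)
       else if onL then x0i :: trav r false onR n                   (* rule 2 *)
       else if negb onR then
         (if isLeaf r then [x1i]                                    (* rule 4 *)
          else x0i :: trav r false false n ++ [x0; x1i])              (* rule 3 *)
       else if negb (right_spine r) then
         x0i :: trav r false true n ++ [x0]                          (* rule 5 *)
       else trav r false onR n)                                     (* rule 6 *)
  end.

Definition gamma (T : tree) : word := trav T true true 0.

(* eta(w) for w with reduced diagram (Tm, Tp) *)
Definition eta (Tm Tp : tree) : word := freduce (inv_word (gamma Tp) ++ gamma Tm).

Definition Felt := R -> R.
Definition comp (g h : Felt) : Felt := fun t => g (h t).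

Definition reachable_in (g h : Felt) (n : nat) : Prop :=
  exists u : word, length u = n /\ comp g (eval u) = h.

(* word metric d_A(g,h) (for g, h in F) *)
Definition dA (g h : Felt) : nat :=
  epsilon (inhabits 0%nat)
    (fun n => reachable_in g h n /\ forall m, reachable_in g h m -> (n <= m)%nat).

(* a point of the geometric realization: at distance al in [0,1] from
   vertex g along the edge from g to g x_a *)
Record point := Pt { pbase : Felt; pgen : gen; palpha : R }.

Definition fgen (a : gen) : Felt := letter_fun (a, false).

Definition gdist (P Q : point) : R :=
  let (g, a, al) := P in
  let (h, b, be) := Q in
  let ga := comp g (fgen a) in
  let hb := comp h (fgen b) in
  let via := Rmin (Rmin (al + INR (dA g h) + be) (al + INR (dA g hb) + (1 - be)))
                  (Rmin ((1 - al) + INR (dA ga h) + be)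
                        ((1 - al) + INR (dA ga hb) + (1 - be))) in
  if excluded_middle_informative (g = h /\ a = b) then Rmin via (Rabs (al - be))
  else via.

Definition vert (y : word) (i : nat) : Felt := eval (firstn i y).

Definition path_pt (y : word) (s : R) : point :=
  if Rle_dec (INR (length y)) s then Pt (vert y (length y)) X0 0
  else
    let i := Z.to_nat (Int_part s) in
    let al := s - INR i in
    match nth i y (X0, false) with
    | (a, false) => Pt (vert y i) a al
    | (a, true) => Pt (vert y (S i)) a (1 - al)
    end.

Definition quasigeodesic (lam eps : R) (y : word) : Prop :=
  forall s t, 0 <= s <= INR (length y) -> 0 <= t <= INR (length y) ->
    (1 / lam) * Rabs (s - t) - eps <= gdist (path_pt y s) (path_pt y t) <=
    lam * Rabs (s - t) + eps.

(* Main.v *)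
(** The caret positions of the infinite binary tree (equivalently the dyadic points
    of the open unit interval) fall into three classes: left spine, right spine and
    interior.  A generator changes the class of exactly one position, and away from
    it acts as a translation of the part of the tree hanging below.  Hence if a word
    u never changes the class of the position t along its trajectory, the map of u
    keeps the class of t and is a translation below t; this fails for at most
    |u| positions.

    Each letter of a nested traversal word changes the class of the position of one
    caret of the tree, and each caret is used at most three times.  For an infix v of
    the normal form, every caret used by v is detected by the map of v: if that map
    were a translation below it, a caret deepest in the translated part would be
    exposed in both trees of the diagram, against reducedness.  So |v| <= 6 |u| for
    every word u representing the same element as v. *)

From Stdlib Require Import Reals List Bool Arith ZArith Lia Lra ClassicalEpsilon FunctionalExtensionality.
Require Import Defs.
Import ListNotations.
Open Scope R_scope.

(** * Generators acting on the infinite binary tree *)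

Definition addr := list bool.

(* An address is the path from the root to a caret of the infinite binary tree,
   [true] meaning right; [mid] is the midpoint of the dyadic interval of the caret. *)
Fixpoint mid (w : addr) : R :=
  match w with
  | [] => 1 / 2
  | b :: u => ((if b then 1 else 0) + mid u) / 2
  end.

Lemma mid_bounds w : 0 < mid w < 1.
Proof. induction w as [|[] w IH]; simpl; lra. Qed.

Lemma mid_inj w w' : mid w = mid w' -> w = w'.
Proof.
  revert w'; induction w as [|b w IH]; intros [|b' w'] E; simpl in E;
    try (pose proof (mid_bounds w)); try (pose proof (mid_bounds w'));
    try destruct b; try destruct b'; try lra; auto;
    f_equal; apply IH; lra.
Qed.

Definition act (l : letter) (w : addr) : addr :=
  match l with
  | (X0, false) =>
      match w with
      | [] => [false]
      | false :: u => false :: false :: u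
      | [true] => []
      | true :: false :: u => false :: true :: u
      | true :: true :: u => true :: u
      end
  | (X0, true) =>
      match w with
      | [] => [true]
      | [false] => []
      | false :: false :: u => false :: u
      | false :: true :: u => true :: false :: u
      | true :: u => true :: true :: u
      end
  | (X1, false) =>
      match w with
      | [true] => [true; false]
      | true :: false :: u => true :: false :: false :: u
      | [true; true] => [true]
      | true :: true :: false :: u => true :: false :: true :: u
      | true :: true :: true :: u => true :: true :: u
      | _ => w
      end
  | (X1, true) =>
      match w with
      | [true] => [true; true]
      | [true; false] => [true]
      | true :: false :: false :: u => true :: false :: u
      | true :: false :: true :: u => true :: true :: false :: u
      | true :: true :: u => true :: true :: true :: u
      | _ => w
      end
  end.

Definition wact (u : word) (w : addr) : addr := fold_right act w u.

Ltac decide_ifs :=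
  repeat match goal with
  | |- context [Rlt_dec ?a ?b] => destruct (Rlt_dec a b); try lra
  | |- context [Rle_dec ?a ?b] => destruct (Rle_dec a b); try lra
  end.

(** The breakpoints of the generators are multiples of 1/8, so three bits of an address select the
    affine branch. *)
Lemma letter_fun_mid l w : letter_fun l (mid w) = mid (act l w).
Proof.
  destruct l as [[] []];
  destruct w as [|[] [|[] [|[] w]]]; simpl;
    try (pose proof (mid_bounds w));
    unfold fx0, fx0inv, fx1, fx1inv, outside; decide_ifs.
Qed.

Lemma eval_mid u w : eval u (mid w) = mid (wact u w).
Proof.
  induction u as [|l u IH]; simpl; [reflexivity|].
  rewrite IH; apply letter_fun_mid.
Qed.

Lemma eval_wact u v : eval u = eval v -> forall w, wact u w = wact v w.
Proof.
  intros E w; apply mid_inj; rewrite <- !eval_mid, E; reflexivity.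
Qed.

Lemma inv_letter_invol l : inv_letter (inv_letter l) = l.
Proof. destruct l as [[] []]; reflexivity. Qed.

Lemma letter_fun_inv l t : letter_fun l (letter_fun (inv_letter l) t) = t.
Proof.
  destruct l as [[] []]; simpl; unfold fx0, fx0inv, fx1, fx1inv, outside; decide_ifs.
Qed.

Lemma inv_word_cons l u : inv_word (l :: u) = inv_word u ++ [inv_letter l].
Proof. reflexivity. Qed.

Lemma inv_word_app u v : inv_word (u ++ v) = inv_word v ++ inv_word u.
Proof. unfold inv_word; rewrite map_app, rev_app_distr; reflexivity. Qed.

Lemma inv_word_invol u : inv_word (inv_word u) = u.
Proof.
  induction u as [|l u IH]; [reflexivity|].
  rewrite inv_word_cons, inv_word_app, IH; simpl; rewrite inv_letter_invol; reflexivity.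
Qed.

Lemma inv_word_length u : length (inv_word u) = length u.
Proof. unfold inv_word; rewrite length_rev, length_map; reflexivity. Qed.

Lemma eval_app u v t : eval (u ++ v) t = eval u (eval v t).
Proof. induction u as [|l u IH]; simpl; congruence. Qed.

Lemma eval_inv u t : eval u (eval (inv_word u) t) = t.
Proof.
  revert t; induction u as [|l u IH]; intro t; [reflexivity|].
  rewrite inv_word_cons, eval_app; simpl. rewrite IH; apply letter_fun_inv.
Qed.

Lemma wact_app u v w : wact (u ++ v) w = wact u (wact v w).
Proof. apply fold_right_app. Qed.

Lemma act_inv l w : act l (act (inv_letter l) w) = w.
Proof. destruct l as [[] []]; destruct w as [|[] [|[] [|[] w]]]; reflexivity. Qed.

Lemma act_inj l w w' : act l w = act l w' -> w = w'.
Proof.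
  intro E. rewrite <- (act_inv (inv_letter l) w), <- (act_inv (inv_letter l) w'), inv_letter_invol, E.
  reflexivity.
Qed.

Lemma wact_inj u w w' : wact u w = wact u w' -> w = w'.
Proof. revert w w'; induction u as [|l u IH]; simpl; intros w w' E; [exact E|]. apply IH, (act_inj l), E. Qed.

Lemma wact_inv u w : wact u (wact (inv_word u) w) = w.
Proof.
  revert w; induction u as [|l u IH]; intro w; [reflexivity|].
  rewrite inv_word_cons, wact_app; simpl. rewrite IH; apply act_inv.
Qed.

Lemma wact_inv_ext u v : (forall w, wact u w = wact v w) -> forall w, wact (inv_word u) w = wact (inv_word v) w.
Proof. intros E w. apply (wact_inj u). rewrite wact_inv, E, wact_inv. reflexivity. Qed.

(** * Classes of positions and their detection by a word *)

Inductive side := OnLeft | OnRight | Inner.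

(** The root lies on both spines and is counted as [OnLeft], so passing between [[true]] and the
    root is a change of class. *)
Definition cls (w : addr) : side :=
  if forallb negb w then OnLeft else if forallb (fun b => b) w then OnRight else Inner.

(* Which part below a position is moved rigidly with it: everything for an interior
   caret, the outer side only for a caret of a spine. *)
Definition below (c : side) (u : addr) : Prop :=
  match c, u with
  | OnLeft, true :: _ => False
  | OnRight, false :: _ => False
  | _, _ => True
  end.

Definition unaffected (f : addr -> addr) (t : addr) : Prop :=
  cls (f t) = cls t /\ forall u, below (cls t) u -> f (t ++ u) = f t ++ u.

(* The position whose class is changed by the letter. *)
Definition moved (l : letter) : addr :=
  match l with
  | (X0, true) => []
  | (X1, true) => [true; false]
  | (_, false) => [true]
  end.

(** Each rule of [act] rewrites a prefix of at most three bits. For a shorter [t] the rule also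
    depends on [u]; on the spines [below] admits only those [u] for which it extends the move of [t]
    itself. *)
Lemma act_unaffected l t : t <> moved l -> unaffected (act l) t.
Proof.
  intro H; destruct l as [[] []];
  destruct t as [|[] [|[] [|[] t]]]; simpl in H; try congruence;
  (split; [unfold cls; simpl; reflexivity|]);
  intros [|[] u]; unfold cls; simpl;
    try (rewrite app_nil_r); try reflexivity; try tauto;
    rewrite ?app_nil_r; try reflexivity; try tauto; destruct u as [|[] u]; reflexivity.
Qed.

(* The positions whose trajectory under [u] changes class at some letter. *)
Fixpoint charges (u : word) : list addr :=
  match u with
  | [] => []
  | l :: u' => wact (inv_word u') (moved l) :: charges u'
  end.

Lemma charges_length u : length (charges u) = length u.
Proof. induction u; simpl; congruence. Qed.

(** While no letter changes the class, the part carried along with the position is of the same kind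
    at each step, so the translations compose. *)
Lemma wact_unaffected u t : ~ In t (charges u) -> unaffected (wact u) t.
Proof.
  induction u as [|l u IH]; intro H.
  - split; [reflexivity|]; intros; reflexivity.
  - assert (Hl : wact u t <> moved l).
    { intro E. apply H. left. rewrite <- E. apply (wact_inj u). apply wact_inv. }
    destruct (IH (fun K => H (or_intror K))) as [C1 A1].
    destruct (act_unaffected l _ Hl) as [C2 A2].
    split; simpl.
    + congruence.
    + intros v Hv. rewrite A1 by exact Hv. apply A2. rewrite C1. exact Hv.
Qed.

(** Every member of [D] must be among the charges of [u], one per letter. *)
Lemma detection_bound u f (D : list addr) :
  NoDup D -> (forall w, wact u w = f w) -> (forall t, In t D -> ~ unaffected f t) ->
  (length D <= length u)%nat.
Proof.
  intros ND E H. rewrite <- charges_length. apply NoDup_incl_length; [exact ND|].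
  intros t Ht. destruct (in_dec (list_eq_dec bool_dec) t (charges u)) as [|N]; [assumption|].
  exfalso. apply (H t Ht). apply wact_unaffected in N.
  unfold unaffected in *; rewrite <- E. split; [tauto|]. intros v Hv. rewrite <- !E. apply N, Hv.
Qed.

(** * Nested traversal words with labelled letters *)

Open Scope nat_scope.

(* [run p] is the action of the inverse of [p]: reading a traversal word letter by
   letter, it follows the carets of the trees R_k into the tree being built. *)
Fixpoint run (p : word) (w : addr) : addr :=
  match p with
  | [] => w
  | l :: p' => run p' (act (inv_letter l) w)
  end.

Lemma run_wact p w : run p w = wact (inv_word p) w.
Proof.
  revert w; induction p as [|l p IH]; intro w; [reflexivity|].
  rewrite inv_word_cons, wact_app; simpl; apply IH.
Qed.

Lemma run_app p q w : run (p ++ q) w = run q (run p w).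
Proof. revert w; induction p; simpl; auto. Qed.

Lemma run_inj p w w' : run p w = run p w' -> w = w'.
Proof. rewrite !run_wact; apply wact_inj. Qed.

Definition lword := list (letter * nat).

(* Letters are labelled by the caret emitting them: the caret with infix number n has
   label n - 1, which is also the number of the leaf immediately to its left. *)
Fixpoint ltrav (T : tree) (onL onR : bool) (off : nat) : lword :=
  match T with
  | Leaf => []
  | Node l r =>
      let k := off + ncarets l in
      ltrav l onL false off ++
      (if k =? 0 then ltrav r false onR (S k)
       else if onL then (x0i, k) :: ltrav r false onR (S k)
       else if negb onR then
         (if isLeaf r then [(x1i, k)]
          else (x0i, k) :: ltrav r false false (S k) ++ [(x0, k); (x1i, k)])
       else if negb (right_spine r) then
         (x0i, k) :: ltrav r false true (S k) ++ [(x0, k)]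
       else ltrav r false onR (S k))
  end.

Lemma ltrav_trav T onL onR off : map fst (ltrav T onL onR off) = trav T onL onR off.
Proof.
  revert onL onR off; induction T as [|l IHl r IHr]; intros; [reflexivity|].
  simpl ltrav; simpl trav. rewrite map_app, IHl. f_equal.
  replace (off + ncarets l + 1) with (S (off + ncarets l)) by lia.
  change (S (off + ncarets l) =? 1) with (off + ncarets l =? 0).
  destruct (off + ncarets l =? 0); [apply IHr|].
  destruct onL; simpl; [rewrite IHr; reflexivity|].
  destruct onR; simpl.
  - destruct (right_spine r); simpl; [apply IHr|]. rewrite map_app, IHr; reflexivity.
  - destruct (isLeaf r); simpl; [reflexivity|]. rewrite map_app, IHr; reflexivity.
Qed.

Definition lgamma (T : tree) : lword := ltrav T true true 0.

Lemma ltrav_labels T onL onR off x k :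
  In (x, k) (ltrav T onL onR off) -> 1 <= k /\ off <= k < off + ncarets T.
Proof.
  revert onL onR off; induction T as [|l IHl r IHr]; intros onL onR off H; [destruct H|].
  simpl in H; apply in_app_or in H as [H|H].
  - apply IHl in H; simpl; lia.
  - simpl ncarets.
    destruct (Nat.eqb_spec (off + ncarets l) 0); [apply IHr in H; lia|].
    assert (Hk : forall a b, In (x, k) (ltrav r a b (S (off + ncarets l))) ->
       1 <= k /\ off <= k < off + S (ncarets l + ncarets r)) by (intros a b K; apply IHr in K; lia).
    assert (Heq : forall y, (y, off + ncarets l) = (x, k) ->
       1 <= k /\ off <= k < off + S (ncarets l + ncarets r)) by (intros y K; injection K; lia).
    destruct onL; [destruct H; eauto|].
    destruct onR; simpl in H.
    + destruct (right_spine r); simpl in H; [eauto|].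
      destruct H as [H|H]; [eauto|]. apply in_app_or in H as [H|[H|[]]]; eauto.
    + destruct (isLeaf r); simpl in H; [destruct H as [H|[]]; eauto|].
      destruct H as [H|H]; [eauto|]. apply in_app_or in H as [H|[H|[H|[]]]]; eauto.
Qed.

Lemma NoDup_app_disj {A} (u v : list A) :
  NoDup u -> NoDup v -> (forall x, In x u -> In x v -> False) -> NoDup (u ++ v).
Proof.
  induction u as [|x u IH]; simpl; intros Hu Hv D; [exact Hv|].
  inversion Hu; subst. constructor.
  - intro K; apply in_app_or in K as [K|K]; eauto.
  - apply IH; eauto.
Qed.

Lemma ltrav_NoDup T onL onR off : NoDup (ltrav T onL onR off).
Proof.
  revert onL onR off; induction T as [|l IHl r IHr]; intros onL onR off; [constructor|].
  simpl; apply NoDup_app_disj; [apply IHl| |].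
  - set (k := off + ncarets l).
    assert (N : forall x a b, ~ In (x, k) (ltrav r a b (S k)))
      by (intros x a b K; apply ltrav_labels in K; lia).
    destruct (k =? 0); [apply IHr|].
    destruct onL; [constructor; auto|].
    destruct onR; simpl.
    + destruct (right_spine r); simpl; [apply IHr|].
      constructor.
      * intro K; apply in_app_or in K as [K|[K|[]]]; [eapply N; eauto|discriminate K].
      * apply NoDup_app_disj; [apply IHr|repeat constructor; intros []|].
        intros x K [<-|[]]; eapply N; eauto.
    + destruct (isLeaf r); simpl; [repeat constructor; intros []|].
      constructor.
      * intro K; apply in_app_or in K as [K|[K|[K|[]]]]; [eapply N; eauto|discriminate K|discriminate K].
      * apply NoDup_app_disj; [apply IHr| |].
        -- repeat constructor; [intros [K|[]]; discriminate K|intros []].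
        -- intros x K [<-|[<-|[]]]; eapply N; eauto.
  - intros [x k] H1 H2. apply ltrav_labels in H1.
    destruct (off + ncarets l =? 0); [apply ltrav_labels in H2; lia|].
    assert (Hk : forall a b, In (x, k) (ltrav r a b (S (off + ncarets l))) -> False)
      by (intros a b K; apply ltrav_labels in K; lia).
    assert (Heq : forall y, (y, off + ncarets l) = (x, k) -> False)
      by (intros y K; injection K; lia).
    destruct onL; [destruct H2; eauto|].
    destruct onR; simpl in H2.
    + destruct (right_spine r); simpl in H2; [eauto|].
      destruct H2 as [H|H]; [eauto|]. apply in_app_or in H as [H|[H|[]]]; eauto.
    + destruct (isLeaf r); simpl in H2; [destruct H2 as [H|[]]; eauto|].
      destruct H2 as [H|H]; [eauto|]. apply in_app_or in H as [H|[H|[H|[]]]]; eauto.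
Qed.

(** * Conditions at the emission of each letter *)

Definition comb (n : nat) : addr := repeat true n.
Arguments comb : simpl never.

(* What holds when caret n emits l, [s k] being the current position of caret k: an
   [x0i] finds nothing built from n on; an [x0] finds an interior caret built to the
   right; an [x1i] finds a caret already built below n unless n is exposed. *)
Definition letter_ok (Ex : nat -> Prop) (s : nat -> addr) (l : letter) (n : nat) : Prop :=
  match l with
  | (X0, true) => forall j, s (n + j) = comb (S j)
  | (X0, false) => s n = [] /\ exists m u, n < m /\ s m = true :: u /\ In false u
  | (X1, true) => s n = [true] /\
      (Ex n \/ exists m u, s m = true :: false :: u \/ s m = true :: true :: false :: u)
  | (X1, false) => False
  end.

Fixpoint letters_ok (Ex : nat -> Prop) (s : nat -> addr) (P : lword) : Prop :=
  match P with
  | [] => True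
  | (l, n) :: Q => letter_ok Ex s l n /\ letters_ok Ex (fun k => act (inv_letter l) (s k)) Q
  end.

Definition runs (P : lword) (s : nat -> addr) (k : nat) : addr := run (map fst P) (s k).

Lemma letters_ok_app Ex s P Q : letters_ok Ex s (P ++ Q) <-> letters_ok Ex s P /\ letters_ok Ex (runs P s) Q.
Proof.
  revert s; induction P as [|[l n] P IH]; intro s; simpl; [unfold runs; simpl; tauto|].
  rewrite IH. unfold runs; simpl. tauto.
Qed.

Lemma letters_ok_weaken (Ex Ex' : nat -> Prop) s P :
  (forall n, Ex n -> Ex' n) -> letters_ok Ex s P -> letters_ok Ex' s P.
Proof.
  intro W; revert s; induction P as [|[l n] P IH]; intro s; simpl; [tauto|].
  intros [H K]; split; [|auto].
  destruct l as [[] []]; simpl in *; auto. destruct H as [? []]; auto.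
Qed.

(** Nothing is built from [off] on: these labels still form a comb whose first position is
    [[true]]. *)
Definition fresh (s : nat -> addr) (off : nat) : Prop := forall j, s (off + j) = comb (S j).

(** Under [run], the [x0i] opening a nested block pushes the root and its left subtree down to the
    left, and the closing [x0] pulls them back; [x1i] does not touch them. *)
Lemma trav_interior_fix T off :
  1 <= off -> run (trav T false false off) [] = [] /\
    forall u, run (trav T false false off) (false :: u) = false :: u.
Proof.
  revert off; induction T as [|l IHl r IHr]; intros off Ho; [split; reflexivity|].
  simpl. destruct (Nat.eqb_spec (off + ncarets l + 1) 1); [lia|].
  destruct (IHl off Ho) as [L1 L2]. destruct (IHr (off + ncarets l + 1) ltac:(lia)) as [R1 R2].
  split; [|intro u]; rewrite run_app, ?L1, ?L2;
    (destruct (isLeaf r); [reflexivity|]); simpl; rewrite run_app, R2; simpl; reflexivity.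
Qed.

(** An interior subtree absorbs its own stretch of the comb: the labels after it move up to
    [[true]], and its root becomes the left child of the first of them. This child is what
    [letter_ok] asks for at later letters. *)
Lemma trav_interior_comb T off :
  1 <= off ->
  (forall j, run (trav T false false off) (comb (ncarets T + S j)) = comb (S j)) /\
  (forall l r, T = Node l r ->
     run (trav T false false off) (comb (S (ncarets l))) = [true; false]).
Proof.
  revert off; induction T as [|l IHl r IHr]; intros off Ho; [split; [reflexivity|discriminate]|].
  simpl. destruct (Nat.eqb_spec (off + ncarets l + 1) 1); [lia|].
  set (k := off + ncarets l + 1) in *.
  destruct (IHl off Ho) as [L1 _]. destruct (IHr k ltac:(lia)) as [R1 _].
  destruct (trav_interior_fix r k ltac:(lia)) as [R0 _].
  split; [intro j|intros l' r' Elr; injection Elr as <- <-]; rewrite run_app.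
  - replace (S (ncarets l + ncarets r + S j)) with (ncarets l + S (ncarets r + S j)) by lia.
    rewrite L1. destruct (isLeaf r) eqn:Er; [destruct r; [destruct j; reflexivity|discriminate]|].
    replace (comb (S (ncarets r + S j))) with (true :: true :: comb (ncarets r + j))
      by (rewrite Nat.add_succ_r; reflexivity).
    simpl run. change (true :: comb (ncarets r + j)) with (comb (S (ncarets r + j))).
    rewrite <- Nat.add_succ_r, run_app, R1. destruct j; reflexivity.
  - replace (S (ncarets l)) with (ncarets l + 1) by lia. rewrite L1.
    destruct (isLeaf r); [reflexivity|]. simpl. rewrite run_app, R0. reflexivity.
Qed.

Lemma exposed_left l r k n : In n (exposed l k) -> In n (exposed (Node l r) k).
Proof.
  destruct l as [|ll lr]; [intros []|]. intro H; simpl. apply in_or_app; left; exact H.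
Qed.

Lemma exposed_right l r k n :
  In n (exposed r (S (k + ncarets l))) -> In n (exposed (Node l r) k).
Proof.
  intro H. replace (S (k + ncarets l)) with (k + nleaves l) in H by (unfold nleaves; lia).
  destruct r as [|rl rr]; [destruct H|]. destruct l; apply in_or_app; right; exact H.
Qed.

Lemma letters_ok_interior T off s :
  1 <= off -> fresh s off ->
  letters_ok (fun n => In n (exposed T off)) s (ltrav T false false off).
Proof.
  revert off s; induction T as [|l IHl r IHr]; intros off s Ho F; [exact I|].
  simpl ltrav. destruct (Nat.eqb_spec (off + ncarets l) 0); [lia|]. simpl negb; cbv iota.
  apply letters_ok_app; split.
  { eapply letters_ok_weaken; [apply exposed_left|apply IHl; auto]. }
  set (k := off + ncarets l) in *.
  set (s1 := runs (ltrav l false false off) s).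
  destruct (trav_interior_comb l off Ho) as [L1 L2].
  assert (F1 : fresh s1 k).
  { intro j. unfold s1, runs. rewrite ltrav_trav, <- L1. f_equal.
    unfold k; rewrite <- Nat.add_assoc, F. f_equal; lia. }
  assert (F1k : s1 k = [true]) by (rewrite <- (Nat.add_0_r k); apply F1).
  destruct r as [|rl rr].
  - simpl isLeaf; cbv iota. split; [split; [exact F1k|]|exact I].
    (* With both subtrees empty the caret is exposed; otherwise [off + ncarets ll] labels the root
       of [l]. *)
    destruct l as [|ll lr]; [left; left; unfold k; simpl; lia|].
    right. exists (off + ncarets ll), []. left. unfold s1, runs.
    rewrite ltrav_trav, F. exact (L2 _ _ eq_refl).
  - remember (Node rl rr) as r eqn:Er. replace (isLeaf r) with false by (rewrite Er; reflexivity).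
    cbv iota. cbn [letters_ok]. split; [exact F1|].
    set (s2 := fun k0 => act (inv_letter x0i) (s1 k0)).
    assert (F2 : fresh s2 (S k)).
    { intro j. unfold s2. replace (S k + j) with (k + S j) by lia. rewrite F1. reflexivity. }
    apply letters_ok_app; split.
    { eapply letters_ok_weaken; [intro; apply exposed_right|]. apply (IHr (S k)); [lia|exact F2]. }
    set (s3 := runs (ltrav r false false (S k)) s2).
    assert (E3 : s3 k = []).
    { unfold s3, runs, s2. rewrite ltrav_trav, F1k. simpl act.
      apply trav_interior_fix; lia. }
    assert (Em : s3 (S k + ncarets rl) = [true; false]).
    { unfold s3, runs. rewrite ltrav_trav, F2.
      exact (proj2 (trav_interior_comb r (S k) ltac:(lia)) _ _ Er). }
    fold s3. repeat split.
    + exact E3.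
    + exists (S k + ncarets rl), [false]. split; [lia|]. split; [exact Em|left; reflexivity].
    + rewrite E3; reflexivity.
    (* The [x0] just emitted has moved the root of [r] from [[true; false]] to
       [[true; true; false]]. *)
    + right. exists (S k + ncarets rl), []. right. rewrite Em; reflexivity.
Qed.

Lemma trav_right_spine T off : 1 <= off -> right_spine T = true -> trav T false true off = [].
Proof.
  revert off; induction T as [|l IHl r IHr]; intros off Ho H; [reflexivity|].
  destruct l; [|discriminate]. simpl in H |- *.
  destruct (Nat.eqb_spec (off + 0 + 1) 1); [lia|]. rewrite H. apply IHr; [lia|exact H].
Qed.

(** The last part yields the interior caret that must exist when a right caret closes its block with
    [x0]: the root of the left subtree if the right one is a spine, and a caret of the right subtree
    otherwise. *)
Lemma trav_right_run T off :
  1 <= off ->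
  run (trav T false true off) [] = [] /\
  (forall u, run (trav T false true off) (false :: u) = false :: u) /\
  (right_spine T = false -> exists j u,
     run (trav T false true off) (comb (S j)) = true :: u /\ In false u).
Proof.
  revert off; induction T as [|l IHl r IHr]; intros off Ho;
    [repeat split; discriminate|].
  simpl trav. destruct (Nat.eqb_spec (off + ncarets l + 1) 1); [lia|].
  set (k := off + ncarets l + 1) in *.
  destruct (trav_interior_fix l off Ho) as [L1 L2].
  destruct (trav_interior_comb l off Ho) as [L3 L4].
  destruct (IHr k ltac:(lia)) as (R1 & R2 & R3).
  destruct (right_spine r) eqn:E; simpl negb; cbv iota.
  - rewrite trav_right_spine, app_nil_r by (auto; lia). repeat split; auto.
    intro H. destruct l as [|ll lr]; [simpl in H; congruence|].
    exists (ncarets ll), [false]. split; [exact (L4 _ _ eq_refl)|left; reflexivity].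
  - repeat split.
    + rewrite run_app, L1. simpl. rewrite run_app, R2. reflexivity.
    + intro u. rewrite run_app, L2. simpl. rewrite run_app, R2. reflexivity.
    + intros _. destruct (R3 eq_refl) as (j & u & H1 & H2).
      exists (ncarets l + S j), (true :: u). split; [|right; exact H2].
      rewrite run_app, <- Nat.add_succ_r, L3. cbn [run app].
      change (act (inv_letter x0i) (comb (S (S j)))) with (comb (S j)). rewrite run_app, H1. reflexivity.
Qed.

Lemma letters_ok_right T off s :
  1 <= off -> fresh s off ->
  letters_ok (fun n => In n (exposed T off)) s (ltrav T false true off).
Proof.
  revert off s; induction T as [|l IHl r IHr]; intros off s Ho F; [exact I|].
  simpl ltrav. destruct (Nat.eqb_spec (off + ncarets l) 0); [lia|]. simpl negb; cbv iota.
  apply letters_ok_app; split.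
  { eapply letters_ok_weaken; [apply exposed_left|apply letters_ok_interior; auto]. }
  set (k := off + ncarets l) in *.
  set (s1 := runs (ltrav l false false off) s).
  destruct (trav_interior_comb l off Ho) as [L1 _].
  assert (F1 : fresh s1 k).
  { intro j. unfold s1, runs. rewrite ltrav_trav, <- L1. f_equal.
    unfold k; rewrite <- Nat.add_assoc, F. f_equal; lia. }
  assert (F1k : s1 k = [true]) by (rewrite <- (Nat.add_0_r k); apply F1).
  destruct (right_spine r) eqn:E; simpl negb; cbv iota.
  { replace (ltrav r false true (S k)) with (@nil (letter * nat)); [exact I|].
    symmetry. apply (map_eq_nil fst). rewrite ltrav_trav. apply trav_right_spine; [lia|exact E]. }
  cbn [letters_ok]. split; [exact F1|].
  set (s2 := fun k0 => act (inv_letter x0i) (s1 k0)).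
  assert (F2 : fresh s2 (S k)).
  { intro j. unfold s2. replace (S k + j) with (k + S j) by lia. rewrite F1. reflexivity. }
  destruct (trav_right_run r (S k) ltac:(lia)) as (R1 & R2 & R3).
  apply letters_ok_app; split.
  { eapply letters_ok_weaken; [intro; apply exposed_right|]. apply (IHr (S k)); [lia|exact F2]. }
  destruct (R3 E) as (j & u & H1 & H2).
  simpl. split; [split|exact I].
  - unfold runs, s2. rewrite ltrav_trav, F1k. exact R1.
  - exists (S k + j), u. split; [lia|]. split; [|exact H2].
    unfold runs. rewrite ltrav_trav, F2. exact H1.
Qed.

(** The first caret in infix order emits nothing, so the comb shifts by one less than the number of
    carets. For the empty tree this would fail, hence the form [Node l r]. *)
Lemma trav_left_comb l r j :
  run (trav (Node l r) true false 0) (comb (ncarets (Node l r) + j)) = comb (S j).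
Proof.
  revert r j; induction l as [|ll IHll lr IHlr]; intros r j.
  - simpl. destruct (trav_interior_comb r 1 (le_n 1)) as [H _].
    rewrite <- Nat.add_succ_r. apply H.
  - assert (L : forall j, run (trav (Node ll lr) true false 0) (comb (ncarets (Node ll lr) + j)) = comb (S j))
      by (apply IHll).
    assert (E : ncarets (Node ll lr) <> 0) by discriminate.
    (* Hiding the shape of [l] keeps [simpl] from unfolding its traversal. *)
    revert L E; generalize (Node ll lr) as l; intros l L E. simpl.
    destruct (Nat.eqb_spec (ncarets l + 1) 1) as [K|_]; [lia|].
    rewrite run_app. replace (S (ncarets l + ncarets r + j)) with (ncarets l + S (ncarets r + j)) by lia.
    rewrite L. cbn [run].
    change (act (inv_letter x0i) (comb (S (S (ncarets r + j))))) with (comb (S (ncarets r + j))).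
    rewrite <- Nat.add_succ_r. apply trav_interior_comb; lia.
Qed.

Lemma letters_ok_left T onR :
  letters_ok (fun n => In n (exposed T 0)) comb (ltrav T true onR 0).
Proof.
  revert onR; induction T as [|l IHl r _]; intro onR; [exact I|].
  simpl ltrav. apply letters_ok_app; split.
  { eapply letters_ok_weaken; [apply exposed_left|apply IHl]. }
  set (s1 := runs (ltrav l true false 0) comb). set (k := ncarets l).
  assert (R : forall s, fresh s (S k) ->
     letters_ok (fun n => In n (exposed (Node l r) 0)) s (ltrav r false onR (S k))).
  { intros s F. eapply letters_ok_weaken; [intro; apply exposed_right|].
    destruct onR; [apply letters_ok_right|apply letters_ok_interior]; auto; simpl; lia. }
  destruct l as [|ll lr].
  (* Rule 1: no letter is emitted, and the labels from 1 on already form the required comb. *)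
  - simpl. apply R. intro j; reflexivity.
  - assert (F1 : fresh s1 k).
    { intro j. unfold s1, runs. rewrite ltrav_trav. apply trav_left_comb. }
    simpl Nat.eqb; cbv iota. split; [exact F1|]. apply R.
    intro j. replace (S k + j) with (k + S j) by lia. rewrite F1. reflexivity.
Qed.

(** * States along a traversal *)

(** [comb k] is the position of label [k] in every right comb with more than [k] carets; the state
    tells where the letters of [P] have carried it. *)
Definition state (P : lword) : nat -> addr := runs P comb.

(** These conditions pass to prefixes, so a partially read word can be treated like a complete
    one. *)
Definition valid (Ex : nat -> Prop) (P : lword) : Prop :=
  letters_ok Ex comb P /\ NoDup P /\ forall x k, In (x, k) P -> 1 <= k.

Definition has_exposed (T : tree) (n : nat) : Prop := In n (exposed T 0).

Lemma lgamma_valid T : valid (has_exposed T) (lgamma T).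
Proof.
  repeat split.
  - apply letters_ok_left.
  - apply ltrav_NoDup.
  - intros x k H; apply ltrav_labels in H; lia.
Qed.

Lemma valid_prefix Ex P Q : valid Ex (P ++ Q) -> valid Ex P.
Proof.
  intros (A & N & L). repeat split.
  - apply letters_ok_app in A; tauto.
  - apply NoDup_app_remove_r in N; exact N.
  - intros x k H; apply (L x k), in_or_app; tauto.
Qed.

Lemma state_snoc P l n k : state (P ++ [(l, n)]) k = act (inv_letter l) (state P k).
Proof. unfold state, runs. rewrite map_app, run_app. reflexivity. Qed.

Lemma comb_inj n m : comb n = comb m -> n = m.
Proof. intro E. rewrite <- (repeat_length true n), <- (repeat_length true m). unfold comb in E; congruence. Qed.

Lemma state_inj P n m : state P n = state P m -> n = m.
Proof. intro E. apply comb_inj, (run_inj (map fst P)), E. Qed.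

Lemma valid_snoc Ex P l n :
  valid Ex (P ++ [(l, n)]) -> valid Ex P /\ letter_ok Ex (state P) l n /\ ~ In (l, n) P /\ 1 <= n.
Proof.
  intro V; split; [eapply valid_prefix; eauto|]. destruct V as (A & N & L).
  apply letters_ok_app in A. destruct A as [_ [A _]]. split; [exact A|]. split.
  - apply NoDup_remove_2 in N. rewrite app_nil_r in N; exact N.
  - apply (L l), in_or_app; right; left; reflexivity.
Qed.

(** A letter pins down the position of its emitter: the one position whose class the step
    changes. *)
Lemma letter_ok_moved Ex s l n : letter_ok Ex s l n -> s n = moved (inv_letter l).
Proof.
  destruct l as [[] []]; simpl; try tauto.
  intro H. rewrite <- (Nat.add_0_r n). apply H.
Qed.

Lemma step_unaffected Ex P l n k :
  valid Ex (P ++ [(l, n)]) -> k <> n -> unaffected (act (inv_letter l)) (state P k).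
Proof.
  intros V H. apply act_unaffected. intro E. apply H, (state_inj P).
  rewrite E. symmetry. eapply letter_ok_moved. apply valid_snoc in V; apply V.
Qed.

Lemma cls_comb_S n : cls (comb (S n)) = OnRight.
Proof.
  unfold cls, comb. simpl. replace (forallb (fun b => b) (repeat true n)) with true; [reflexivity|].
  induction n; auto.
Qed.

(* The class of a label records its last event. *)
Lemma class_history Ex P n :
  valid Ex P -> 1 <= n ->
  match cls (state P n) with
  | Inner => In (x1i, n) P
  | OnLeft => In (x0i, n) P
  | OnRight => In (x0, n) P \/ forall l, ~ In (l, n) P
  end.
Proof.
  intros V Hn. induction P as [|[l k] P IH] using rev_ind.
  - destruct n; [lia|]. change (state [] (S n)) with (comb (S n)). rewrite cls_comb_S.
    right; intros ? [].
  - destruct (valid_snoc _ _ _ _ V) as (V' & O & N & _).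
    rewrite state_snoc. destruct (Nat.eq_dec n k) as [->|Hk].
    + rewrite (letter_ok_moved _ _ _ _ O).
      destruct l as [[] []]; simpl in O |- *; try contradiction; unfold cls; simpl;
        try left; apply in_or_app; right; left; reflexivity.
    + destruct (step_unaffected _ _ _ _ _ V Hk) as [-> _]. specialize (IH V').
      destruct (cls (state P n)); try (apply in_or_app; tauto).
      destruct IH as [IH|IH]; [left; apply in_or_app; tauto|right].
      intros x K; apply in_app_or in K as [K|[K|[]]]; [eapply IH; eauto|congruence].
Qed.

(** No letter is emitted from an interior position, so a caret keeps its class once it has emitted
    [x1i]. *)
Lemma x1i_Inner Ex P n : valid Ex P -> In (x1i, n) P -> cls (state P n) = Inner.
Proof.
  intros V. induction P as [|[l k] P IH] using rev_ind; [intros []|].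
  intro H. destruct (valid_snoc _ _ _ _ V) as (V' & O & N & _).
  rewrite state_snoc. destruct (Nat.eq_dec n k) as [->|Hk].
  - apply in_app_or in H as [H|[H|[]]].
    + specialize (IH V' H). rewrite (letter_ok_moved _ _ _ _ O) in *.
      destruct l as [[] []]; simpl in *; try contradiction; discriminate.
    + injection H as ->. rewrite (letter_ok_moved _ _ _ _ O); reflexivity.
  - destruct (step_unaffected _ _ _ _ _ V Hk) as [-> _]. apply IH; [exact V'|].
    apply in_app_or in H as [H|[H|[]]]; [exact H|congruence].
Qed.

Lemma in_valid_split Ex P l n :
  valid Ex P -> In (l, n) P -> exists P1 P2, P = P1 ++ (l, n) :: P2 /\ valid Ex (P1 ++ [(l, n)]).
Proof.
  intros V H. apply in_split in H as (P1 & P2 & ->). exists P1, P2; split; [reflexivity|].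
  apply (valid_prefix _ _ P2). rewrite <- app_assoc; exact V.
Qed.

Lemma x0_x0i Ex P n : valid Ex P -> In (x0, n) P -> In (x0i, n) P.
Proof.
  intros V H. destruct (in_valid_split _ _ _ _ V H) as (P1 & P2 & -> & V1).
  destruct (valid_snoc _ _ _ _ V1) as (V' & O & _ & Hn).
  pose proof (class_history _ _ _ V' Hn) as C. rewrite (letter_ok_moved _ _ _ _ O) in C.
  apply in_or_app; left; exact C.
Qed.

(** Only a second [x0i] of the same caret could return it to the left spine, and labelled letters do
    not repeat. *)
Lemma x0_not_OnLeft Ex P n : valid Ex P -> In (x0, n) P -> cls (state P n) <> OnLeft.
Proof.
  intros V. induction P as [|[l k] P IH] using rev_ind; [intros []|].
  intro H. destruct (valid_snoc _ _ _ _ V) as (V' & O & N & _).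
  rewrite state_snoc. destruct (Nat.eq_dec n k) as [->|Hk].
  - rewrite (letter_ok_moved _ _ _ _ O). intro C. apply in_app_or in H as [H|[H|[]]].
    + apply N. destruct l as [[] []]; simpl in *; try contradiction; try discriminate.
      eapply x0_x0i; eauto.
    + injection H as ->. discriminate.
  - destruct (step_unaffected _ _ _ _ _ V Hk) as [-> _]. apply IH; [exact V'|].
    apply in_app_or in H as [H|[H|[]]]; [exact H|congruence].
Qed.

Lemma cls_OnRight w : cls w = OnRight -> exists j, w = comb (S j).
Proof.
  unfold cls. intro H. destruct (forallb negb w) eqn:E1; [discriminate|].
  destruct (forallb (fun b => b) w) eqn:E2; [|discriminate].
  destruct w as [|b w]; [discriminate|]. exists (length w).
  apply (Forall_eq_repeat (x := true)), Forall_forall. rewrite forallb_forall in E2.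
  intros x K; symmetry; exact (E2 x K).
Qed.

Lemma cls_OnLeft w : cls w = OnLeft -> exists j, w = repeat false j.
Proof.
  unfold cls. intro H. destruct (forallb negb w) eqn:E1;
  [|destruct (forallb (fun b => b) w); discriminate].
  exists (length w). apply Forall_eq_repeat, Forall_forall. rewrite forallb_forall in E1.
  intros x K; symmetry; apply negb_true_iff, E1, K.
Qed.

Lemma cls_Inner_iff w : cls w = Inner <-> In true w /\ In false w.
Proof.
  unfold cls. destruct (forallb negb w) eqn:E1.
  - split; [discriminate|]. intros [H _]. rewrite forallb_forall in E1. apply E1 in H; discriminate.
  - destruct (forallb (fun b => b) w) eqn:E2.
    + split; [discriminate|]. intros [_ H]. rewrite forallb_forall in E2. apply E2 in H; discriminate.
    + split; [intros _|reflexivity]. split.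
      * destruct (in_dec bool_dec true w) as [|N]; [assumption|].
        enough (forallb negb w = true) by congruence.
        apply forallb_forall. intros [] K; [contradiction|reflexivity].
      * destruct (in_dec bool_dec false w) as [|N]; [assumption|].
        enough (forallb (fun b => b) w = true) by congruence.
        apply forallb_forall. intros [] K; [reflexivity|contradiction].
Qed.

Lemma cls_Inner_ext w u : cls w = Inner -> cls (w ++ u) = Inner.
Proof. rewrite !cls_Inner_iff. intros [H1 H2]; split; apply in_or_app; tauto. Qed.

(** At the emission of [x0] an interior caret exists beyond [n]. While [n] stays on the right spine,
    this caret hangs on its outer side and is carried along. *)
Lemma crossed_back Ex P n :
  valid Ex P -> In (x0, n) P -> cls (state P n) = OnRight ->
  exists m u, n < m /\ state P m = state P n ++ true :: u /\ cls (state P m) = Inner.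
Proof.
  intros V. induction P as [|[l k] P IH] using rev_ind; [intros []|].
  intro H. destruct (valid_snoc _ _ _ _ V) as (V' & O & N & Hk1).
  rewrite state_snoc. destruct (Nat.eq_dec n k) as [->|Hk]; intro C.
  - apply in_app_or in H as [H|[H|[]]].
    + rewrite (letter_ok_moved _ _ _ _ O) in C. destruct l as [[] []]; simpl in *; try contradiction; discriminate.
    + injection H as ->. destruct O as [O1 (m & u & O2 & O3 & O4)].
      exists m, u. rewrite state_snoc, O1, O3. split; [exact O2|]. split; [reflexivity|].
      apply cls_Inner_iff; split; simpl; tauto.
  - destruct (step_unaffected _ _ _ _ _ V Hk) as [U1 U2]. rewrite U1 in C.
    destruct IH as (m & u & M1 & M2 & M3); [exact V'| |exact C|].
    { apply in_app_or in H as [H|[H|[]]]; [exact H|congruence]. }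
    exists m, u. split; [exact M1|].
    assert (E : state (P ++ [(l, k)]) m = act (inv_letter l) (state P n) ++ true :: u).
    { rewrite state_snoc, M2. apply U2. rewrite C. exact I. }
    split; [exact E|]. rewrite E. rewrite M2 in M3.
    rewrite cls_Inner_iff in *. destruct (cls_OnRight _ C) as [j Ej].
    destruct (cls_OnRight (act (inv_letter l) (state P n))) as [j' Ej']; [congruence|].
    rewrite Ej'. rewrite Ej in M3. destruct M3 as [_ M3]. split.
    + apply in_or_app; right; left; reflexivity.
    + apply in_app_or in M3 as [M3|M3]; [apply repeat_spec in M3; discriminate|].
      apply in_or_app; right; exact M3.
Qed.

(** The alternative holds at the emission of [x1i]; afterwards everything below the now interior
    caret moves rigidly with it. *)
Lemma built_exposed_or_child Ex P n :
  valid Ex P -> In (x1i, n) P ->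
  Ex n \/ exists m u, u <> [] /\ state P m = state P n ++ u.
Proof.
  intros V. induction P as [|[l k] P IH] using rev_ind; [intros []|].
  intro H. destruct (valid_snoc _ _ _ _ V) as (V' & O & N & _).
  destruct (Nat.eq_dec n k) as [->|Hk].
  - apply in_app_or in H as [H|[H|[]]].
    + pose proof (x1i_Inner _ _ _ V' H) as C. rewrite (letter_ok_moved _ _ _ _ O) in C.
      destruct l as [[] []]; simpl in *; try contradiction; discriminate.
    + injection H as ->. destruct O as [O1 [O2|(m & u & O2)]]; [left; exact O2|right].
      rewrite state_snoc, O1. exists m.
      destruct O2 as [O2|O2]; [exists (false :: u)|exists (true :: u)];
        (split; [discriminate|]); rewrite state_snoc, O2; reflexivity.
  - assert (H' : In (x1i, n) P) by (apply in_app_or in H as [H|[H|[]]]; [exact H|congruence]).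
    destruct (IH V' H') as [|(m & u & Hu & E)]; [tauto|]. right. exists m, u. split; [exact Hu|].
    rewrite !state_snoc, E. apply (step_unaffected _ _ _ _ _ V Hk).
    rewrite (x1i_Inner _ _ _ V' H'). exact I.
Qed.

Lemma label0_OnLeft Ex P : valid Ex P -> cls (state P 0) = OnLeft.
Proof.
  induction P as [|[l k] P IH] using rev_ind; intro V; [reflexivity|].
  destruct (valid_snoc _ _ _ _ V) as (V' & _ & _ & K).
  rewrite state_snoc. destruct (step_unaffected _ _ _ _ 0 V) as [-> _]; [lia|auto].
Qed.

Lemma Inner_x1i Ex P n : valid Ex P -> cls (state P n) = Inner -> In (x1i, n) P.
Proof.
  intros V C. destruct n as [|n]; [rewrite (label0_OnLeft _ _ V) in C; discriminate|].
  pose proof (class_history _ _ (S n) V ltac:(lia)) as K. rewrite C in K; exact K.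
Qed.

(* A built caret deepest below [m] is exposed in both trees. *)
Lemma no_common_caret Ta Tb P Q f :
  reduced Ta Tb -> valid (has_exposed Ta) P -> valid (has_exposed Tb) Q ->
  (forall n, f (state P n) = state Q n) -> (forall w w', f w = f w' -> w = w') ->
  forall m, cls (state P m) = Inner -> cls (state Q m) = Inner ->
  (forall u, f (state P m ++ u) = state Q m ++ u) -> False.
Proof.
  intros Red VP VQ Hf Inj m0 I1 I2 Hm.
  (* [B] bounds the depth of all interior carets, since each has emitted a letter of [P]; the
     induction descends towards this bound. *)
  set (B := list_max (map (fun p => length (state P (snd p))) P)).
  assert (Main : forall d m u, state P m = state P m0 ++ u -> B - length (state P m) <= d -> False).
  { induction d as [|d IH]; intros m u E Hd.
    all: assert (C1 : cls (state P m) = Inner) by (rewrite E; apply cls_Inner_ext, I1).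
    all: assert (E2 : state Q m = state Q m0 ++ u) by (rewrite <- Hf, E; apply Hm).
    all: assert (C2 : cls (state Q m) = Inner) by (rewrite E2; apply cls_Inner_ext, I2).
    all: assert (Child : forall m' u', u' <> [] -> state P m' = state P m ++ u' ->
       length (state P m') <= B /\ length (state P m) < length (state P m')).
    1, 3: intros m' u' Hu' E'; split;
      [|rewrite E', length_app; destruct u'; [congruence|simpl; lia]].
    1, 2: assert (K : In (x1i, m') P) by (apply (Inner_x1i _ _ _ VP); rewrite E'; apply cls_Inner_ext, C1);
      pose proof (proj1 (list_max_le (map (fun p => length (state P (snd p))) P) B) (le_n _)) as LM;
      rewrite Forall_forall in LM; apply LM;
      exact (in_map (fun p : letter * nat => length (state P (snd p))) P (x1i, m') K).
    (* [m] cannot be exposed in both trees, and a caret found below it on the [Q] side is pulled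
       back through [f]. *)
    all: assert (Step : exists m' u', u' <> [] /\ state P m' = state P m ++ u').
    1, 3: destruct (built_exposed_or_child _ _ _ VP (Inner_x1i _ _ _ VP C1)) as [X1|]; [|assumption];
      destruct (built_exposed_or_child _ _ _ VQ (Inner_x1i _ _ _ VQ C2)) as [X2|(m' & u' & Hu' & E')];
      [exfalso; exact (Red m X1 X2)|];
      exists m', u'; split; [exact Hu'|]; apply Inj;
      rewrite Hf, E', E2, E, <- !app_assoc; symmetry; apply Hm.
    all: destruct Step as (m' & u' & Hu' & E'); destruct (Child m' u' Hu' E').
    - lia.
    - apply (IH m' (u ++ u')); [rewrite E', E, app_assoc; reflexivity|lia]. }
  apply (Main (B - length (state P m0)) m0 []); [rewrite app_nil_r; reflexivity|lia].
Qed.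

(** * Lower bounds for infixes *)

(* Infix order on the carets of the infinite binary tree. *)
Fixpoint before (w w' : addr) : bool :=
  match w, w' with
  | [], [] => false
  | [], b :: _ => b
  | b :: _, [] => negb b
  | b :: u, b' :: u' => if Bool.eqb b b' then before u u' else b'
  end.

Lemma before_act l w w' : before (act l w) (act l w') = before w w'.
Proof.
  destruct l as [[] []];
  destruct w as [|[] [|[] [|[] w]]]; destruct w' as [|[] [|[] [|[] w']]]; reflexivity.
Qed.

Lemma before_run p w w' : before (run p w) (run p w') = before w w'.
Proof.
  revert w w'; induction p as [|l p IH]; intros w w'; cbn [run]; [reflexivity|].
  rewrite IH; apply before_act.
Qed.

Lemma before_left_spine w j :
  before w (repeat false j) = true -> exists u, w = repeat false j ++ false :: u.
Proof.
  revert w; induction j as [|j IH]; intros [|[] w] H; simpl in *; try discriminate.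
  - exists w; reflexivity.
  - destruct (IH w H) as [u ->]. exists u; reflexivity.
Qed.

Lemma valid_letters Ex P l n : valid Ex P -> In (l, n) P -> In l [x0i; x0; x1i].
Proof.
  intros V H. destruct (in_valid_split _ _ _ _ V H) as (P1 & _ & _ & V1).
  apply valid_snoc in V1. destruct V1 as (_ & O & _).
  destruct l as [[] []]; simpl in *; unfold x0, x0i, x1i; tauto.
Qed.

(** A caret emits each of the three letters at most once; this is the factor 3 of the length
    estimates. *)
Lemma letter_label_count (V : lword) (L : list nat) :
  NoDup V -> (forall l n, In (l, n) V -> In l [x0i; x0; x1i] /\ In n L) -> length V <= 3 * length L.
Proof.
  intros ND H. change 3 with (length [x0i; x0; x1i]). rewrite <- length_prod.
  apply NoDup_incl_length; [exact ND|]. intros [l n] K. apply in_prod; apply (H l n K).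
Qed.

Lemma state_app P Q k : state (P ++ Q) k = run (map fst Q) (state P k).
Proof. unfold state, runs. rewrite map_app, run_app. reflexivity. Qed.

Lemma detected_labels_bound u f P (L : list nat) :
  (forall w, wact u w = f w) -> (forall n, In n L -> ~ unaffected f (state P n)) ->
  length (nodup Nat.eq_dec L) <= length u.
Proof.
  intros E H. rewrite <- (length_map (state P)). apply (detection_bound u f); [|exact E|].
  - apply NoDup_map_NoDup_ForallPairs; [|apply NoDup_nodup].
    intros x y _ _. apply state_inj.
  - intros t Ht. apply in_map_iff in Ht as (n & <- & Hn). apply H. apply nodup_In in Hn; exact Hn.
Qed.

Lemma in_labels (V : lword) n : In n (map snd V) -> exists l, In (l, n) V.
Proof. intro H. apply in_map_iff in H as ([l k] & E & H). simpl in E; subst. exists l; exact H. Qed.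

Lemma valid_disjoint Ex P Q l n : valid Ex (P ++ Q) -> In (l, n) P -> In (l, n) Q -> False.
Proof.
  intros (_ & ND & _) H1 H2. apply in_split in H2 as (Q1 & Q2 & ->).
  rewrite app_assoc in ND. apply NoDup_remove_2 in ND. apply ND.
  apply in_or_app; left; apply in_or_app; left; exact H1.
Qed.

(** The map of [V] carries final positions back to those after [A]. If [n] were unaffected, both
    would have the same class, and each class contradicts the record of letters emitted by [n]. *)
Lemma infix_detected Ex A V n :
  valid Ex (A ++ V) -> In n (map snd V) ->
  ~ unaffected (wact (map fst V)) (state (A ++ V) n).
Proof.
  intros VV Hn [C U].
  assert (VA : valid Ex A) by (eapply valid_prefix; eauto).
  assert (F : forall k, wact (map fst V) (state (A ++ V) k) = state A k).
  { intro k. rewrite state_app, run_wact. apply wact_inv. }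
  rewrite F in C, U.
  destruct (in_labels _ _ Hn) as [l Hl].
  assert (HlP : In (l, n) (A ++ V)) by (apply in_or_app; right; exact Hl).
  assert (Hn1 : 1 <= n) by (apply VV in HlP; exact HlP).
  pose proof (valid_letters _ _ _ _ VV HlP) as HL.
  pose proof (class_history _ _ _ VA Hn1) as HA.
  pose proof (class_history _ _ _ VV Hn1) as HV.
  (* After an [x0] in [A], only [x1i] is left for [n] to emit. *)
  assert (Back : In (x0, n) A -> cls (state (A ++ V) n) = Inner).
  { intro K. destruct HL as [<-|[<-|[<-|[]]]].
    - exfalso. apply (valid_disjoint Ex A V x0i n VV); [exact (x0_x0i _ _ _ VA K)|exact Hl].
    - exfalso. exact (valid_disjoint Ex A V x0 n VV K Hl).
    - eapply x1i_Inner; eauto. }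
  (* A caret interior after [A] would be silent throughout [V]. *)
  assert (NI : cls (state (A ++ V) n) <> Inner).
  { intro K. rewrite C, K in HA. apply in_split in Hl as (V1 & V2 & ->).
    assert (VS : valid Ex ((A ++ V1) ++ [(l, n)]))
      by (apply (valid_prefix _ _ V2); rewrite <- !app_assoc; exact VV).
    destruct (valid_snoc _ _ _ _ VS) as (V' & O & _).
    pose proof (x1i_Inner _ _ n V' (in_or_app _ _ _ (or_introl HA))) as K'.
    rewrite (letter_ok_moved _ _ _ _ O) in K'. destruct HL as [<-|[<-|[<-|[]]]]; discriminate. }
  destruct (cls (state (A ++ V) n)) eqn:E; [|clear NI|congruence].
  - rewrite C in HA. destruct HL as [<-|[<-|[<-|[]]]].
    + exact (valid_disjoint Ex A V _ n VV HA Hl).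
    + exact (x0_not_OnLeft _ _ _ VV HlP E).
    + apply (x1i_Inner _ _ _ VV) in HlP. congruence.
  - rewrite C in HA. destruct HA as [HA|HA]; [specialize (Back HA); discriminate|].
    destruct HV as [HV|HV]; [|apply (HV l HlP)].
    (* The caret [m] is interior at the end, hence by translation already after [A]; but the [x0i]
       of [n] in [V] must find nothing built from [n] on. *)
    destruct (crossed_back _ _ _ VV HV E) as (m & u & M1 & M2 & M3).
    assert (M4 : state A m = state A n ++ true :: u).
    { rewrite <- F, M2. apply U. exact I. }
    assert (M5 : cls (state A m) = Inner).
    { rewrite M4. rewrite M2 in M3. rewrite cls_Inner_iff in *.
      destruct (cls_OnRight _ E) as [j Ej]. rewrite Ej in M3. destruct M3 as [_ M3].
      split; apply in_or_app; right; [left; reflexivity|].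
      apply in_app_or in M3 as [M3|M3]; [apply repeat_spec in M3; discriminate|exact M3]. }
    apply (x0_x0i _ _ _ VV) in HV. apply in_app_or in HV as [HV|HV]; [apply (HA _ HV)|].
    apply in_split in HV as (V1 & V2 & ->).
    assert (VS : valid Ex ((A ++ V1) ++ [(x0i, n)]))
      by (apply (valid_prefix _ _ V2); rewrite <- !app_assoc; exact VV).
    destruct (valid_snoc _ _ _ _ VS) as (V' & O & _).
    assert (M6 : cls (state (A ++ V1) m) = Inner).
    { eapply x1i_Inner; [exact V'|]. apply in_or_app; left. eapply Inner_x1i; eauto. }
    replace m with (n + (m - n)) in M6 by lia. rewrite O, cls_comb_S in M6. discriminate.
Qed.

Lemma infix_bound Ex A V u :
  valid Ex (A ++ V) -> (forall w, wact u w = wact (map fst V) w) -> length V <= 3 * length u.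
Proof.
  intros VV E.
  assert (B : length (nodup Nat.eq_dec (map snd V)) <= length u).
  { apply (detected_labels_bound u (wact (map fst V)) (A ++ V)); [exact E|].
    intros n Hn. eapply infix_detected; eauto. }
  enough (length V <= 3 * length (nodup Nat.eq_dec (map snd V))) by lia.
  apply letter_label_count.
  - destruct VV as (_ & ND & _). apply NoDup_app_remove_l in ND; exact ND.
  - intros l n H. split.
    + eapply valid_letters; [exact VV|]. apply in_or_app; right; exact H.
    + apply nodup_In, in_map_iff. exists (l, n); auto.
Qed.

(** A common [x1i] would build a caret at the same place for both trees, against reducedness; an
    [x0] presupposes an interior caret, hence an earlier [x1i]. *)
Lemma common_prefix_x0i Ta Tb K l n :
  reduced Ta Tb -> valid (has_exposed Ta) K -> valid (has_exposed Tb) K -> In (l, n) K -> l = x0i.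
Proof.
  intros Red VA VB H.
  assert (N : forall k, ~ In (x1i, k) K).
  { intros k Hk. apply (no_common_caret Ta Tb K K (fun w => w) Red VA VB) with (m := k); auto;
      eapply x1i_Inner; eauto. }
  destruct (valid_letters _ _ _ _ VA H) as [<-|[<-|[<-|[]]]]; [reflexivity| |exfalso; eapply N; eauto].
  exfalso. destruct (in_valid_split _ _ _ _ VA H) as (K1 & K2 & -> & V1).
  destruct (valid_snoc _ _ _ _ V1) as (V' & [_ (m & u & _ & E & Hu)] & _).
  apply (N m), in_or_app; left. apply (Inner_x1i _ _ _ V').
  rewrite E. apply cls_Inner_iff; simpl; tauto.
Qed.

(** On the outer side of a spine caret, being interior depends on the class of that caret and on
    [b :: u], not on its depth. *)
Lemma cls_region w w' b u :
  cls w' = cls w -> cls w <> Inner -> below (cls w) (b :: u) ->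
  cls (w ++ b :: u) = Inner -> cls (w' ++ b :: u) = Inner.
Proof.
  intros E N Ad H. rewrite cls_Inner_iff in H |- *. destruct (cls w) eqn:C; [| |congruence].
  - destruct b; [destruct Ad|]. destruct (cls_OnLeft _ C) as [j ->]. destruct H as [H _].
    apply in_app_or in H as [H|H]; [apply repeat_spec in H; discriminate|].
    split; apply in_or_app; right; [exact H|left; reflexivity].
  - destruct b; [|destruct Ad]. destruct (cls_OnRight _ C) as [j ->]. destruct H as [_ H].
    apply in_app_or in H as [H|H]; [apply repeat_spec in H; discriminate|].
    split; apply in_or_app; right; [left; reflexivity|exact H].
Qed.

(** [q] emits from [[true]], so it precedes every other label on the right spine. The action
    preserves infix order, and what precedes a left spine position lies in its left subtree. *)
Lemma head_caret_left Ex K q A n :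
  valid Ex (K ++ (x1i, q) :: A) -> cls (state K n) = OnRight ->
  cls (state (K ++ (x1i, q) :: A) n) = OnLeft ->
  exists u, state (K ++ (x1i, q) :: A) q = state (K ++ (x1i, q) :: A) n ++ false :: u
    /\ cls (state (K ++ (x1i, q) :: A) q) = Inner.
Proof.
  intros V C1 C2.
  assert (Cq : cls (state (K ++ (x1i, q) :: A) q) = Inner)
    by (eapply x1i_Inner; [exact V|]; apply in_or_app; right; left; reflexivity).
  assert (Eq : state K q = [true]).
  { assert (V' : valid Ex (K ++ [(x1i, q)])) by (apply (valid_prefix _ _ A); rewrite <- app_assoc; exact V).
    apply valid_snoc in V'. apply V'. }
  assert (Nq : n <> q) by (intros ->; congruence).
  assert (B : before (state K q) (state K n) = true).
  { destruct (cls_OnRight _ C1) as [[|j] E].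
    - exfalso. apply Nq, (state_inj K). rewrite E, Eq; reflexivity.
    - rewrite E, Eq; reflexivity. }
  rewrite <- (before_run (map fst ((x1i, q) :: A))), <- !state_app in B.
  destruct (cls_OnLeft _ C2) as [j E]. rewrite E in *.
  destruct (before_left_spine _ _ B) as [u Hu]. exists u. auto.
Qed.

Definition heads_differ (A B : lword) : Prop :=
  match A, B with
  | (l, _) :: _, (l', _) :: _ => l <> l'
  | _, _ => True
  end.

(** If [n] were unaffected, an interior caret moving rigidly with it would be common to both trees;
    each class of [n] supplies one. *)
Lemma bridge_detected Ta Tb K A B f n :
  reduced Ta Tb -> valid (has_exposed Ta) (K ++ A) -> valid (has_exposed Tb) (K ++ B) ->
  heads_differ A B ->
  (forall k, f (state (K ++ A) k) = state (K ++ B) k) -> (forall w w', f w = f w' -> w = w') ->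
  In n (map snd A ++ map snd B) -> ~ unaffected f (state (K ++ A) n).
Proof.
  intros Red VA VB HD F Inj Hn [C U]. rewrite F in C, U.
  (* It suffices to find, after either word, an interior caret on the outer side of the spine caret
     [n]. *)
  assert (Close : forall b u m, cls (state (K ++ A) n) <> Inner -> below (cls (state (K ++ A) n)) (b :: u) ->
     (state (K ++ A) m = state (K ++ A) n ++ b :: u /\ cls (state (K ++ A) m) = Inner \/
      state (K ++ B) m = state (K ++ B) n ++ b :: u /\ cls (state (K ++ B) m) = Inner) -> False).
  { intros b u m NI Ad H.
    assert (EA : state (K ++ A) m = state (K ++ A) n ++ b :: u).
    { destruct H as [[H _]|[H _]]; [exact H|]. apply Inj. rewrite F, H. symmetry; apply U, Ad. }
    assert (EB : state (K ++ B) m = state (K ++ B) n ++ b :: u).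
    { rewrite <- F, EA. apply U, Ad. }
    apply (no_common_caret Ta Tb (K ++ A) (K ++ B) f Red VA VB F Inj m).
    - destruct H as [[_ H]|[_ H]]; [exact H|]. rewrite EA. rewrite EB in H.
      apply (cls_region (state (K ++ B) n)); congruence.
    - destruct H as [[_ H]|[_ H]]; [|exact H]. rewrite EB. rewrite EA in H.
      apply (cls_region (state (K ++ A) n)); congruence.
    - intro v. rewrite EA, EB, <- !app_assoc. apply U, Ad. }
  assert (Hl : (exists l, In (l, n) A) \/ (exists l, In (l, n) B)).
  { apply in_app_or in Hn as [Hn|Hn]; [left|right]; apply in_labels, Hn. }
  assert (HlP : (exists l, In (l, n) (K ++ A)) /\ 1 <= n \/ (exists l, In (l, n) (K ++ B)) /\ 1 <= n).
  { destruct Hl as [[l Hl]|[l Hl]]; [left|right];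
      (assert (Hl' := in_or_app K _ _ (or_intror Hl)); split; [exists l; exact Hl'|]);
      [apply VA in Hl'|apply VB in Hl']; exact Hl'. }
  assert (Hn1 : 1 <= n) by tauto.
  pose proof (class_history _ _ _ VA Hn1) as HA.
  pose proof (class_history _ _ _ VB Hn1) as HB.
  rewrite C in HB.
  destruct (cls (state (K ++ A) n)) eqn:E.
  (* Having emitted [x0i] in [K], the caret could emit nothing more and still end on the left
     spine. *)
  - assert (NK : forall l, ~ In (l, n) K).
    { intros l H.
      assert (Ex := common_prefix_x0i Ta Tb K l n Red (valid_prefix _ _ _ VA) (valid_prefix _ _ _ VB) H).
      subst l.
      assert (Aux : forall T X, valid (has_exposed T) (K ++ X) -> cls (state (K ++ X) n) = OnLeft ->
         forall l, In (l, n) X -> False).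
      { intros T X VX CX l HX. assert (HX' := in_or_app K _ _ (or_intror HX)).
        destruct (valid_letters _ _ _ _ VX HX') as [<-|[<-|[<-|[]]]].
        - exact (valid_disjoint _ K X _ n VX H HX).
        - exact (x0_not_OnLeft _ _ _ VX HX' CX).
        - apply (x1i_Inner _ _ _ VX) in HX'. congruence. }
      destruct Hl as [[l Hl]|[l Hl]]; [eapply (Aux Ta A)|eapply (Aux Tb B)]; eauto; congruence. }
    assert (CK : cls (state K n) = OnRight).
    { pose proof (class_history _ _ _ (valid_prefix _ _ _ VA) Hn1) as HK.
      destruct (cls (state K n)); [destruct (NK _ HK)|reflexivity|destruct (NK _ HK)]. }
    (* An [x0] presupposes an interior caret, and none is built in [K]. *)
    assert (NotX0 : forall T q X, valid (has_exposed T) (K ++ (x0, q) :: X) -> False).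
    { intros T q X VX.
      assert (V' : valid (has_exposed T) (K ++ [(x0, q)]))
        by (apply (valid_prefix _ _ X); rewrite <- app_assoc; exact VX).
      destruct (valid_snoc _ _ _ _ V') as (VK & [_ (m & u & _ & Em & Hu)] & _).
      assert (Hm : In (x1i, m) K).
      { apply (Inner_x1i _ _ _ VK). rewrite Em. apply cls_Inner_iff; simpl; tauto. }
      assert (Ex := common_prefix_x0i Ta Tb K _ m Red (valid_prefix _ _ _ VA) (valid_prefix _ _ _ VB) Hm).
      discriminate Ex. }
    destruct A as [|[la qa] A]; [rewrite app_nil_r in HA; apply (NK _ HA)|].
    destruct B as [|[lb qb] B]; [rewrite app_nil_r in HB; apply (NK _ HB)|].
    simpl in HD.
    (* The heads are [x0i] and [x1i] in some order, so one word goes on by building a caret that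
       ends up in the left subtree of [n]. *)
    destruct (valid_letters _ _ la qa VA) as [<-|[<-|[<-|[]]]];
      [apply in_or_app; right; left; reflexivity| |exfalso; eapply NotX0; eauto|].
    + destruct (valid_letters _ _ lb qb VB) as [<-|[<-|[<-|[]]]];
        [apply in_or_app; right; left; reflexivity|congruence|exfalso; eapply NotX0; eauto|].
      destruct (head_caret_left _ _ _ _ _ VB CK C) as (u & H1 & H2).
      apply (Close false u qb); [discriminate|exact I|right; auto].
    + destruct (head_caret_left _ _ _ _ _ VA CK E) as (u & H1 & H2).
      apply (Close false u qa); [discriminate|exact I|left; auto].
  (* A caret that has emitted a letter and lies on the right spine must have emitted [x0]. *)
  - assert (Touched : In (x0, n) (K ++ A) \/ In (x0, n) (K ++ B)).
    { destruct HlP as [[[l Hl'] _]|[[l Hl'] _]]; [left; destruct HA as [HA|HA]|right; destruct HB as [HB|HB]];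
        solve [assumption | exfalso; eapply HA; eassumption | exfalso; eapply HB; eassumption]. }
    destruct Touched as [H|H].
    + destruct (crossed_back _ _ _ VA H E) as (m & u & _ & M2 & M3).
      apply (Close true u m); [discriminate|exact I|left; auto].
    + destruct (crossed_back _ _ _ VB H C) as (m & u & _ & M2 & M3).
      apply (Close true u m); [discriminate|exact I|right; auto].
  - apply (no_common_caret Ta Tb (K ++ A) (K ++ B) f Red VA VB F Inj n E C).
    intro v; apply U; exact I.
Qed.

(** The two words together use at most [length u] labels, and each word uses a label at most three
    times; hence the constant 6. *)
Lemma bridge_bound Ta Tb K A B u :
  reduced Ta Tb -> valid (has_exposed Ta) (K ++ A) -> valid (has_exposed Tb) (K ++ B) ->
  heads_differ A B ->
  (forall w, wact u w = wact (inv_word (map fst B) ++ map fst A) w) ->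
  length A + length B <= 6 * length u.
Proof.
  intros Red VA VB HD E.
  assert (Bd : length (nodup Nat.eq_dec (map snd A ++ map snd B)) <= length u).
  { apply (detected_labels_bound u _ (K ++ A) _ E). intros n Hn.
    apply (bridge_detected Ta Tb K A B); auto.
    - intro k. rewrite wact_app, !state_app, (run_wact (map fst A)), wact_inv, run_wact. reflexivity.
    - intros w w'. apply wact_inj. }
  assert (Cnt : forall T X, valid (has_exposed T) (K ++ X) -> incl (map snd X) (map snd A ++ map snd B) ->
     length X <= 3 * length (nodup Nat.eq_dec (map snd A ++ map snd B))).
  { intros T X VX HX. apply letter_label_count.
    - destruct VX as (_ & ND & _). apply NoDup_app_remove_l in ND; exact ND.
    - intros l n H. split.
      + eapply valid_letters; [exact VX|]. apply in_or_app; right; exact H.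
      + apply nodup_In, HX, in_map_iff. exists (l, n); auto. }
  pose proof (Cnt _ _ VA (incl_appl _ (incl_refl _))).
  pose proof (Cnt _ _ VB (incl_appr _ (incl_refl _))). lia.
Qed.

(** * Free reduction of the normal form *)

Fixpoint freely_reduced (w : word) : Prop :=
  match w with
  | l :: (m :: _) as u => m <> inv_letter l /\ freely_reduced u
  | _ => True
  end.

Definition push (l : letter) (acc : word) : word :=
  match acc with
  | h :: t => if letter_eqb h (inv_letter l) then t else l :: acc
  | [] => [l]
  end.

Lemma letter_eqb_eq l m : letter_eqb l m = true <-> l = m.
Proof. destruct l as [[] []], m as [[] []]; split; intro; (reflexivity || discriminate). Qed.

Lemma push_reduced l u : freely_reduced (l :: u) -> push l u = l :: u.
Proof.
  destruct u as [|m u]; [reflexivity|]. intros [H _]; simpl.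
  destruct (letter_eqb m (inv_letter l)) eqn:E; [|reflexivity].
  apply letter_eqb_eq in E; contradiction.
Qed.

Lemma freely_reduced_tail l u : freely_reduced (l :: u) -> freely_reduced u.
Proof. destruct u; [intros _; exact I|intros [_ H]; exact H]. Qed.

Lemma freely_reduced_app_r u v : freely_reduced (u ++ v) -> freely_reduced v.
Proof. induction u as [|l u IH]; [auto|]. intro H; apply IH, (freely_reduced_tail l), H. Qed.

Lemma push_app u v : freely_reduced (u ++ v) -> fold_right push v u = u ++ v.
Proof.
  induction u as [|l u IH]; [reflexivity|]. intro H; simpl.
  rewrite IH by (apply freely_reduced_tail in H; exact H). apply push_reduced, H.
Qed.

Lemma push_cancel u v : fold_right push (u ++ v) (inv_word u) = v.
Proof.
  revert v; induction u as [|l u IH]; intro v; [reflexivity|].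
  rewrite inv_word_cons, fold_right_app. simpl.
  replace (letter_eqb l (inv_letter (inv_letter l))) with true; [apply IH|].
  symmetry; apply letter_eqb_eq; symmetry; apply inv_letter_invol.
Qed.

Lemma inv_word_app_reduced u v :
  freely_reduced u -> freely_reduced v ->
  match u, v with l :: _, m :: _ => l <> m | _, _ => True end ->
  freely_reduced (inv_word u ++ v).
Proof.
  revert v; induction u as [|l u IH]; intros v Hu Hv H; [exact Hv|].
  rewrite inv_word_cons, <- app_assoc. simpl. apply IH.
  - apply freely_reduced_tail in Hu; exact Hu.
  - destruct v as [|m v]; [exact I|]. split; [rewrite inv_letter_invol; congruence|exact Hv].
  - destruct u as [|m u]; [exact I|]. apply Hu.
Qed.

(** Both factors being reduced, cancellation happens only at the junction and stops where the
    remainders differ. *)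
Lemma freduce_common_prefix k a b :
  freely_reduced (k ++ a) -> freely_reduced (k ++ b) ->
  match b, a with l :: _, m :: _ => l <> m | _, _ => True end ->
  freduce (inv_word (k ++ b) ++ k ++ a) = inv_word b ++ a.
Proof.
  intros Ha Hb H. change freduce with (fold_right push []).
  rewrite inv_word_app, !fold_right_app. rewrite <- (fold_right_app push k a []).
  rewrite (push_app (k ++ a) []) by (rewrite app_nil_r; exact Ha).
  rewrite app_nil_r, push_cancel. apply push_app.
  apply inv_word_app_reduced; eauto using freely_reduced_app_r.
Qed.

(** Since [x1] is never emitted, adjacent inverses could only be [x0] and [x0i], both from one caret
    [n]. The first demands an interior caret beyond [n], the second that all labels from [n] on form
    a comb. *)
Lemma letters_ok_freely_reduced Ex s P :
  (forall n m, s n = s m -> n = m) -> letters_ok Ex s P -> freely_reduced (map fst P).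
Proof.
  revert s; induction P as [|[l n] P IH]; intros s Inj H; [exact I|].
  destruct H as [O H].
  assert (R : freely_reduced (map fst P)).
  { apply (IH _ (fun i j E => Inj i j (act_inj _ _ _ E)) H). }
  destruct P as [|[m k] P]; [exact I|]. split; [|exact R].
  simpl fst; intros ->. destruct H as [O' _].
  destruct l as [[] []]; try contradiction; simpl in O, O'.
  - destruct O' as [E1 (i & u & Hi & E & Hu)].
    assert (En : n = k).
    { apply Inj. pose proof (O 0) as E0. rewrite Nat.add_0_r in E0. rewrite E0.
      apply (act_inj x0). unfold x0; simpl. rewrite E1. reflexivity. }
    subst k. replace i with (n + S (i - S n)) in E by lia. rewrite O in E.
    injection E as <-. apply repeat_spec in Hu; discriminate.
  - destruct O as [En (i & u & Hi & E & Hu)].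
    assert (Ek : k = n).
    { apply Inj. pose proof (O' 0) as E0. rewrite Nat.add_0_r in E0.
      apply (act_inj x0i). unfold x0i; simpl. rewrite E0, En. reflexivity. }
    subst k. specialize (O' (i - n)). replace (n + (i - n)) with i in O' by lia.
    rewrite E in O'. injection O' as O'. destruct (i - n) as [|j]; [discriminate|].
    injection O' as ->. apply repeat_spec in Hu; discriminate.
Qed.

Lemma lgamma_fst T : map fst (lgamma T) = gamma T.
Proof. apply ltrav_trav. Qed.

Lemma gamma_freely_reduced T : freely_reduced (gamma T).
Proof.
  rewrite <- lgamma_fst. apply (letters_ok_freely_reduced (has_exposed T) comb); [exact comb_inj|].
  apply lgamma_valid.
Qed.

Lemma common_prefix {A} (dec : forall x y : A, {x = y} + {x <> y}) (u v : list A) :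
  exists k u' v', u = k ++ u' /\ v = k ++ v' /\
    match u', v' with x :: _, y :: _ => x <> y | _, _ => True end.
Proof.
  revert v; induction u as [|x u IH]; intro v; [exists [], [], v; auto|].
  destruct v as [|y v]; [exists [], (x :: u), []; auto|].
  destruct (dec x y) as [->|N]; [|exists [], (x :: u), (y :: v); auto].
  destruct (IH v) as (k & u' & v' & -> & -> & H). exists (y :: k), u', v'; auto.
Qed.

Lemma eta_split Tm Tp : exists K A B,
  lgamma Tm = K ++ A /\ lgamma Tp = K ++ B /\ heads_differ A B /\
  eta Tm Tp = inv_word (map fst B) ++ map fst A.
Proof.
  assert (dec : forall x y : letter * nat, {x = y} + {x <> y}) by (repeat decide equality).
  destruct (common_prefix dec (lgamma Tm) (lgamma Tp)) as (K & A & B & EA & EB & H).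
  assert (HD : heads_differ A B).
  (* Equal letters in the same state have the same emitter, so heads that differ with labels differ
     as letters. *)
  { destruct A as [|[l n] A], B as [|[l' n'] B]; simpl; auto. intros <-. apply H; f_equal.
    pose proof (lgamma_valid Tm) as VA. pose proof (lgamma_valid Tp) as VB.
    rewrite EA in VA. rewrite EB in VB.
    change ((l, n) :: A) with ([(l, n)] ++ A) in VA. change ((l, n') :: B) with ([(l, n')] ++ B) in VB.
    rewrite app_assoc in VA, VB. apply valid_prefix, valid_snoc in VA, VB.
    apply (state_inj K). destruct VA as (_ & OA & _), VB as (_ & OB & _).
    rewrite (letter_ok_moved _ _ _ _ OA), (letter_ok_moved _ _ _ _ OB). reflexivity. }
  exists K, A, B. repeat split; auto. unfold eta.
  pose proof (gamma_freely_reduced Tm) as RA. pose proof (gamma_freely_reduced Tp) as RB.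
  rewrite <- lgamma_fst, EA, map_app in RA. rewrite <- lgamma_fst, EB, map_app in RB.
  rewrite <- !lgamma_fst, EA, EB, !map_app.
  apply freduce_common_prefix; auto.
  destruct A as [|[l n] A], B as [|[l' n'] B]; simpl in *; auto.
Qed.

(** An infix either lies in one half of the normal form, where the factor 3 suffices, or crosses the
    junction. *)
Lemma eta_infix_bound Tm Tp p v q u :
  reduced Tm Tp -> eta Tm Tp = p ++ v ++ q -> (forall w, wact u w = wact v w) ->
  length v <= 6 * length u.
Proof.
  intros Red E Hu. destruct (eta_split Tm Tp) as (K & A & B & EA & EB & HD & EE).
  pose proof (lgamma_valid Tm) as VA. pose proof (lgamma_valid Tp) as VB.
  rewrite EA in VA. rewrite EB in VB. rewrite E in EE. clear E EA EB.
  symmetry in EE. apply app_eq_app in EE as (l & [[E1 E2]|[E1 E2]]).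
  - apply app_eq_app in E2 as (l' & [[E2 E3]|[E2 E3]]).
    + apply map_eq_app in E3 as (A1 & A2 & -> & E3 & _).
      (* The part of [v] before the junction inverts a prefix of [B], so truncating both words keeps
         validity and heads. *)
      apply (f_equal inv_word) in E1. rewrite inv_word_invol, inv_word_app in E1.
      apply map_eq_app in E1 as (B1 & B2 & -> & E1 & _).
      rewrite app_assoc in VA, VB. apply valid_prefix in VA, VB.
      assert (Ev : v = inv_word (map fst B1) ++ map fst A1)
        by (rewrite E1, inv_word_invol, E3; exact E2).
      rewrite Ev in *. rewrite length_app, inv_word_length, !length_map.
      enough (length A1 + length B1 <= 6 * length u) by lia.
      apply (bridge_bound Tm Tp K A1 B1 u Red VA VB); [|exact Hu].
      destruct A1 as [|[] A1], B1 as [|[] B1]; simpl in *; auto.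
    + rewrite E2, app_assoc in E1.
      apply (f_equal inv_word) in E1. rewrite inv_word_invol, !inv_word_app in E1.
      apply map_eq_app in E1 as (B1 & B2 & -> & _ & E1).
      apply map_eq_app in E1 as (B3 & B4 & -> & E1 & _).
      rewrite !app_assoc in VB. apply valid_prefix in VB.
      (* Here [v] inverts an infix of [B], so the estimate is applied to the inverse of [u]. *)
      pose proof (infix_bound _ _ _ (inv_word u) VB) as Bd.
      rewrite E1, <- (length_map fst B3), E1, !inv_word_length in Bd.
      specialize (Bd (wact_inv_ext u v Hu)). lia.
  - apply map_eq_app in E2 as (A1 & A2 & -> & _ & E2).
    apply map_eq_app in E2 as (A3 & A4 & -> & E2 & _).
    rewrite !app_assoc in VA. apply valid_prefix in VA.
    pose proof (infix_bound _ _ _ u VA) as Bd.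
    rewrite E2, <- (length_map fst A3), E2 in Bd. specialize (Bd Hu). lia.
Qed.

(** * Points of the Cayley graph *)

Open Scope R_scope.

Lemma least_nat (P : nat -> Prop) n : P n -> exists m, P m /\ forall k, P k -> (m <= k)%nat.
Proof.
  induction n as [n IH] using lt_wf_ind; intro H.
  destruct (excluded_middle_informative (exists k, (k < n)%nat /\ P k)) as [(k & Hk & Pk)|N].
  - exact (IH k Hk Pk).
  - exists n; split; [exact H|]. intros k Pk. destruct (le_lt_dec n k) as [|L]; [assumption|].
    exfalso; eauto.
Qed.

Lemma dA_reachable g h n : reachable_in g h n -> reachable_in g h (dA g h) /\ (dA g h <= n)%nat.
Proof.
  intro H. destruct (least_nat (reachable_in g h) n H) as [m Hm].
  unfold dA. match goal with |- context [epsilon ?i ?P] => pose proof (epsilon_spec i P (ex_intro _ m Hm)) as E end.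
  destruct E as [E1 E2]; split; [exact E1|exact (E2 n H)].
Qed.

Lemma comp_eval u v : comp (eval u) (eval v) = eval (u ++ v).
Proof. apply functional_extensionality; intro t. unfold comp. rewrite eval_app; reflexivity. Qed.

Lemma dA_eval p q : exists u, length u = dA (eval p) (eval q) /\ eval (p ++ u) = eval q.
Proof.
  destruct (dA_reachable (eval p) (eval q) (length (inv_word p ++ q))) as [(u & H1 & H2) _].
  - exists (inv_word p ++ q); split; [reflexivity|]. rewrite comp_eval.
    apply functional_extensionality; intro t. rewrite !eval_app, eval_inv; reflexivity.
  - exists u; split; [exact H1|]. rewrite <- comp_eval; exact H2.
Qed.

Lemma dA_le p q u : eval (p ++ u) = eval q -> (dA (eval p) (eval q) <= length u)%nat.
Proof.
  intro H. apply dA_reachable. exists u; split; [reflexivity|]. rewrite comp_eval; exact H.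
Qed.

Lemma firstn_segment {A} (y : list A) i j :
  (i <= j)%nat -> firstn j y = firstn i y ++ firstn (j - i) (skipn i y).
Proof.
  intro H. replace j with (i + (j - i))%nat at 1 by lia. generalize (j - i)%nat; clear.
  revert i; induction y as [|a y IH]; intros [|i] k; simpl; auto.
  - rewrite !firstn_nil; reflexivity.
  - f_equal; apply IH.
Qed.

Lemma segment_split {A} (y : list A) i j :
  y = firstn i y ++ firstn (j - i) (skipn i y) ++ skipn (j - i) (skipn i y).
Proof. rewrite firstn_skipn, firstn_skipn; reflexivity. Qed.

Lemma firstn_S_nth {A} (d : A) (y : list A) i :
  (i < length y)%nat -> firstn (S i) y = firstn i y ++ [nth i y d].
Proof.
  revert i; induction y as [|b y IH]; intros [|i] H; simpl in *; try lia; [reflexivity|].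
  f_equal. apply IH; lia.
Qed.

Lemma vert_S y i : (i < length y)%nat -> vert y (S i) = comp (vert y i) (letter_fun (@nth letter i y (X0, false))).
Proof.
  intro H. change (letter_fun (@nth letter i y (X0, false))) with (eval [nth i y (X0, false)]).
  unfold vert at 2. rewrite comp_eval, <- firstn_S_nth by exact H. reflexivity.
Qed.

Lemma vert_backward y i a :
  (i < length y)%nat -> @nth letter i y (X0, false) = (a, true) ->
  comp (vert y (S i)) (fgen a) = vert y i.
Proof.
  intros Hi Hn. rewrite vert_S, Hn by exact Hi. apply functional_extensionality; intro t.
  unfold comp, fgen. f_equal. exact (letter_fun_inv (a, true) t).
Qed.

Lemma vert_forward y i a :
  (i < length y)%nat -> @nth letter i y (X0, false) = (a, false) ->
  comp (vert y i) (fgen a) = vert y (S i).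
Proof. intros Hi Hn. rewrite vert_S, Hn by exact Hi. reflexivity. Qed.

(** Agreement on addresses follows from equality of the homeomorphisms by [eval_wact], so the bound
    covers every [u] with the same value as [v]. *)
Definition infix_bounded (c : nat) (y : word) : Prop :=
  forall p v q u, y = p ++ v ++ q -> (forall w, wact u w = wact v w) ->
  (length v <= c * length u)%nat.

Lemma vertex_lower c y i j u :
  infix_bounded c y -> (i <= length y)%nat -> (j <= length y)%nat ->
  eval (firstn i y ++ u) = eval (firstn j y) ->
  Rabs (INR i - INR j) <= INR c * INR (length u).
Proof.
  intros B Hi Hj E. rewrite <- mult_INR. pose proof (eval_wact _ _ E) as W. clear E.
  destruct (le_lt_dec i j) as [L|L].
  - rewrite (firstn_segment y i j L) in W.
    set (v := firstn (j - i) (skipn i y)) in *.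
    assert (Bd : (length v <= c * length u)%nat).
    { apply (B _ _ _ u (segment_split y i j)). intro w. specialize (W w).
      rewrite !wact_app in W. apply wact_inj in W. exact W. }
    unfold v in Bd. rewrite length_firstn, length_skipn, Nat.min_l in Bd by lia.
    rewrite Rabs_minus_sym, Rabs_pos_eq, <- minus_INR by (auto; apply le_INR in L; lra).
    apply le_INR, Bd.
  - rewrite (firstn_segment y j i ltac:(lia)) in W.
    set (v := firstn (i - j) (skipn j y)) in *.
    assert (Bd : (length v <= c * length (inv_word u))%nat).
    { apply (B _ _ _ (inv_word u) (segment_split y j i)). intro w.
      specialize (W (wact (inv_word u) w)). rewrite !wact_app, wact_inv in W.
      apply wact_inj in W. symmetry; exact W. }
    unfold v in Bd. rewrite length_firstn, length_skipn, inv_word_length, Nat.min_l in Bd by lia.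
    apply Nat.lt_le_incl in L.
    rewrite Rabs_pos_eq, <- minus_INR by (auto; apply le_INR in L; lra).
    apply le_INR, Bd.
Qed.

Lemma vertex_upper y i j :
  (i <= j <= length y)%nat ->
  INR (dA (vert y i) (vert y j)) <= INR j - INR i /\ INR (dA (vert y j) (vert y i)) <= INR j - INR i.
Proof.
  intros [H1 H2]. rewrite <- minus_INR by exact H1.
  set (v := firstn (j - i) (skipn i y)).
  assert (Lv : length v = (j - i)%nat).
  { unfold v. rewrite length_firstn, length_skipn, Nat.min_l by lia. reflexivity. }
  unfold vert. split; apply le_INR; rewrite <- Lv, ?(firstn_segment y i j H1); fold v.
  - apply dA_le; reflexivity.
  - rewrite <- (inv_word_length v). apply dA_le.
    apply functional_extensionality; intro t. rewrite !eval_app, eval_inv. reflexivity.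
Qed.

(** [h] is an endpoint of the edge carrying [P], at distance [d] along that edge. *)
Definition ends (P : point) (h : Felt) (d : R) : Prop :=
  (h = pbase P /\ d = palpha P) \/ (h = comp (pbase P) (fgen (pgen P)) /\ d = 1 - palpha P).

Lemma Rmin_cases a b : Rmin a b <= a /\ Rmin a b <= b /\ (Rmin a b = a \/ Rmin a b = b).
Proof. unfold Rmin; destruct (Rle_dec a b); lra. Qed.

Lemma gdist_le P Q h k d e : ends P h d -> ends Q k e -> gdist P Q <= d + INR (dA h k) + e.
Proof.
  destruct P as [g a al], Q as [g' b be]. unfold ends; simpl. intros H1 H2.
  set (r1 := al + _ + be). set (r2 := al + _ + (1 - be)).
  set (r3 := 1 - al + _ + be). set (r4 := 1 - al + _ + (1 - be)).
  assert (V : Rmin (Rmin r1 r2) (Rmin r3 r4) <= d + INR (dA h k) + e).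
  { destruct (Rmin_cases r1 r2) as (?&?&_), (Rmin_cases r3 r4) as (?&?&_),
      (Rmin_cases (Rmin r1 r2) (Rmin r3 r4)) as (?&?&_).
    destruct H1 as [[-> ->]|[-> ->]], H2 as [[-> ->]|[-> ->]]; unfold r1, r2, r3, r4 in *; lra. }
  destruct (excluded_middle_informative _); [|exact V].
  eapply Rle_trans; [apply Rmin_l|exact V].
Qed.

Lemma gdist_edge_le P Q :
  pbase P = pbase Q -> pgen P = pgen Q -> gdist P Q <= Rabs (palpha P - palpha Q).
Proof.
  destruct P as [g a al], Q as [g' b be]. simpl. intros -> ->.
  destruct (excluded_middle_informative _) as [_|N]; [apply Rmin_r|].
  exfalso; apply N; auto.
Qed.

Lemma gdist_ge P Q r :
  (forall h k d e, ends P h d -> ends Q k e -> r <= d + INR (dA h k) + e) ->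
  (pbase P = pbase Q -> pgen P = pgen Q -> r <= Rabs (palpha P - palpha Q)) ->
  r <= gdist P Q.
Proof.
  destruct P as [g a al], Q as [g' b be]. unfold ends; simpl. intros H1 H2.
  assert (V : forall h k d e, (h = g /\ d = al \/ h = comp g (fgen a) /\ d = 1 - al) ->
     (k = g' /\ e = be \/ k = comp g' (fgen b) /\ e = 1 - be) -> r <= d + INR (dA h k) + e) by auto.
  destruct (excluded_middle_informative _) as [[E1 E2]|_];
    repeat apply Rmin_glb; try (apply V; tauto). auto.
Qed.

Lemma Int_part_nat s : 0 <= s ->
  INR (Z.to_nat (Int_part s)) <= s < INR (Z.to_nat (Int_part s)) + 1.
Proof.
  intro H. destruct (base_Int_part s) as [H1 H2].
  assert (0 <= Int_part s)%Z.
  { enough (-1 < Int_part s)%Z by lia. apply lt_IZR. lra. }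
  rewrite INR_IZR_INZ, Z2Nat.id by assumption. lra.
Qed.

Lemma path_pt_edge y s : 0 <= s < INR (length y) ->
  exists i, (i < length y)%nat /\ INR i <= s < INR i + 1 /\ path_pt y s =
    match @nth letter i y (X0, false) with
    | (a, false) => Pt (vert y i) a (s - INR i)
    | (a, true) => Pt (vert y (S i)) a (1 - (s - INR i))
    end.
Proof.
  intros [H1 H2]. exists (Z.to_nat (Int_part s)). pose proof (Int_part_nat s H1).
  split; [apply INR_lt; lra|]. split; [assumption|]. unfold path_pt.
  destruct (Rle_dec _ _); [lra|]. destruct (nth _ _ _) as [a []]; reflexivity.
Qed.

Lemma path_pt_last y s : s = INR (length y) -> path_pt y s = Pt (vert y (length y)) X0 0.
Proof. intros ->. unfold path_pt. destruct (Rle_dec _ _); [reflexivity|lra]. Qed.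

(** The alternatives are an edge run forwards, an edge run backwards, and the end of the path,
    placed by convention at the start of an [X0] edge. *)
Lemma path_pt_base y s : 0 <= s <= INR (length y) ->
  exists i a al, path_pt y s = Pt (vert y i) a al /\ 0 <= al <= 1 /\ (i <= length y)%nat /\
   ((s = INR i + al /\ (S i <= length y)%nat /\ comp (vert y i) (fgen a) = vert y (S i)) \/
    (s = INR i - al /\ exists k, i = S k /\ comp (vert y i) (fgen a) = vert y k) \/
    (s = INR i /\ al = 0)).
Proof.
  intros [H1 [H2|H2]].
  - destruct (path_pt_edge y s (conj H1 H2)) as (i & Hi & Hs & E).
    destruct (@nth letter i y (X0, false)) as [a []] eqn:En; rewrite E.
    + exists (S i), a, (1 - (s - INR i)). rewrite S_INR.
      repeat split; [lra|lra|lia|right; left]. split; [lra|]. exists i; split; [reflexivity|].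
      apply vert_backward; assumption.
    + exists i, a, (s - INR i).
      repeat split; [lra|lra|lia|left]. split; [lra|]. split; [lia|].
      apply vert_forward; assumption.
  - exists (length y), X0, 0. rewrite path_pt_last by exact H2. repeat split; auto; lra.
Qed.

(** The detour [b] serves the end of the path, where the far end of the conventional [X0] edge may
    lie off the path. *)
Definition near (y : word) (s : R) (h : Felt) (d : R) : Prop :=
  exists i b, (i <= length y)%nat /\ h = eval (firstn i y ++ b) /\
    Rabs (s - INR i) + INR (length b) <= d.

Lemma path_pt_near y s h d :
  0 <= s <= INR (length y) -> ends (path_pt y s) h d -> near y s h d.
Proof.
  intros Hs. destruct (path_pt_base y s Hs) as (i & a & al & -> & Hal & Hi & C).
  unfold ends; simpl. intros [[-> ->]|[-> ->]].
  - exists i, []. rewrite app_nil_r. repeat split; [exact Hi|]. simpl.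
    destruct C as [(-> & _)|[(-> & _)|(-> & _)]]; unfold Rabs; destruct (Rcase_abs _); lra.
  - destruct C as [(-> & C1 & C2)|[(-> & k & -> & C2)|(-> & ->)]].
    + exists (S i), []. rewrite app_nil_r, C2. repeat split; [exact C1|].
      rewrite S_INR; simpl length; simpl INR; unfold Rabs; destruct (Rcase_abs _); lra.
    + exists k, []. rewrite app_nil_r, C2. repeat split; [lia|].
      rewrite S_INR; simpl length; simpl INR; unfold Rabs; destruct (Rcase_abs _); lra.
    + exists i, [(a, false)]. rewrite <- comp_eval. repeat split; [exact Hi|].
      simpl length; simpl INR; unfold Rabs; destruct (Rcase_abs _); lra.
Qed.

(** The detours and a shortest word form one word joining two path vertices. As [c] is at least 1,
    [d] and [e] also pay for the offsets of [s] and [t]. *)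
Lemma near_lower c y s t h k d e :
  (1 <= c)%nat -> infix_bounded c y -> near y s h d -> near y t k e ->
  1 / INR c * Rabs (s - t) <= d + INR (dA h k) + e.
Proof.
  intros Hc B (i & b & Hi & -> & Hd) (j & b' & Hj & -> & He).
  destruct (dA_eval (firstn i y ++ b) (firstn j y ++ b')) as (u & <- & E).
  assert (L := vertex_lower c y i j (b ++ u ++ inv_word b') B Hi Hj).
  rewrite !length_app, inv_word_length, !plus_INR in L.
  assert (Hc' : 1 <= INR c) by (apply (le_INR 1) in Hc; exact Hc).
  apply (Rmult_le_reg_l (INR c)); [lra|].
  replace (INR c * (1 / INR c * Rabs (s - t))) with (Rabs (s - t)) by (field; lra).
  assert (T : Rabs (s - t) <= Rabs (s - INR i) + Rabs (INR i - INR j) + Rabs (t - INR j)).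
  { replace (s - t) with ((s - INR i) + (INR i - INR j) + (INR j - t)) by lra.
    rewrite (Rabs_minus_sym t). eapply Rle_trans; [apply Rabs_triang|].
    apply Rplus_le_compat_r, Rabs_triang. }
  assert (L' : Rabs (INR i - INR j) <= INR c * (INR (length b) + (INR (length u) + INR (length b')))).
  { apply L. apply functional_extensionality; intro x.
    rewrite (app_assoc b), (app_assoc (firstn i y)), (app_assoc (firstn i y)).
    rewrite eval_app, E, eval_app, eval_inv. reflexivity. }
  pose proof (Rabs_pos (s - INR i)). pose proof (Rabs_pos (t - INR j)). nra.
Qed.

Lemma vert_inj c y i j :
  infix_bounded c y -> (i <= length y)%nat -> (j <= length y)%nat ->
  vert y i = vert y j -> i = j.
Proof.
  intros B Hi Hj E. pose proof (vertex_lower c y i j [] B Hi Hj) as L.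
  rewrite app_nil_r in L. specialize (L E). simpl in L. rewrite Rmult_0_r in L.
  apply INR_eq. revert L; unfold Rabs; destruct (Rcase_abs _); lra.
Qed.

Lemma path_pt_left_end y s : 0 <= s <= INR (length y) ->
  exists i, (i <= length y)%nat /\ INR i <= s < INR i + 1 /\ ends (path_pt y s) (vert y i) (s - INR i) /\
   ((i < length y)%nat -> ends (path_pt y s) (vert y (S i)) (INR i + 1 - s)).
Proof.
  intros [H1 [H2|H2]].
  - destruct (path_pt_edge y s (conj H1 H2)) as (i & Hi & Hs & E).
    exists i. split; [lia|]. split; [exact Hs|].
    destruct (@nth letter i y (X0, false)) as [a []] eqn:En; rewrite E; unfold ends; simpl.
    + rewrite (vert_backward y i a Hi En).
      split; [right; split; [reflexivity|lra]|intros _; left; split; [reflexivity|lra]].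
    + rewrite (vert_forward y i a Hi En).
      split; [left; split; [reflexivity|lra]|intros _; right; split; [reflexivity|lra]].
  - exists (length y). split; [lia|]. split; [lra|]. rewrite path_pt_last by exact H2. split; [|lia].
    left; split; simpl; [reflexivity|lra].
Qed.

(** The path itself is a route: through the vertex after the smaller parameter and the vertex before
    the larger one, or directly within one edge. *)
Lemma path_pt_upper y s t :
  0 <= s <= INR (length y) -> 0 <= t <= INR (length y) ->
  gdist (path_pt y s) (path_pt y t) <= Rabs (s - t).
Proof.
  intros Hs Ht.
  destruct (path_pt_left_end y s Hs) as (i & Hi & Hsi & Li & Ri).
  destruct (path_pt_left_end y t Ht) as (j & Hj & Htj & Lj & Rj).
  destruct (lt_eq_lt_dec i j) as [[L|<-]|L].
  - eapply Rle_trans; [apply (gdist_le _ _ _ _ _ _ (Ri ltac:(lia)) Lj)|].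
    destruct (vertex_upper y (S i) j ltac:(lia)) as [U _]. rewrite S_INR in U.
    rewrite Rabs_minus_sym. eapply Rle_trans; [|apply Rle_abs]. lra.
  - destruct Hs as [Hs [Hs'|Hs']], Ht as [Ht [Ht'|Ht']].
    + destruct (path_pt_edge y s (conj Hs Hs')) as (i1 & _ & H1 & E1).
      destruct (path_pt_edge y t (conj Ht Ht')) as (i2 & _ & H2 & E2).
      assert (Same : forall a b x, INR a <= x < INR a + 1 -> INR b <= x < INR b + 1 -> a = b).
      { intros a b x Ha Hb. rewrite <- !S_INR in *.
        assert (a < S b)%nat by (apply INR_lt; lra). assert (b < S a)%nat by (apply INR_lt; lra). lia. }
      rewrite (Same i1 i s) in * by assumption. rewrite (Same i2 i t) in * by assumption.
      rewrite E1, E2. destruct (@nth letter i y (X0, false)) as [a []];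
        (eapply Rle_trans; [apply gdist_edge_le; reflexivity|]); simpl.
      * rewrite (Rabs_minus_sym s). right; f_equal; lra.
      * right; f_equal; lra.
    + exfalso. assert (length y < S i)%nat by (apply INR_lt; rewrite S_INR; lra).
      assert (i = length y) by lia. subst i. lra.
    + exfalso. assert (length y < S i)%nat by (apply INR_lt; rewrite S_INR; lra).
      assert (i = length y) by lia. subst i. lra.
    + rewrite !path_pt_last by assumption.
      eapply Rle_trans; [apply gdist_edge_le; reflexivity|]. simpl. right; f_equal; lra.
  - eapply Rle_trans; [apply (gdist_le _ _ _ _ _ _ Li (Rj ltac:(lia)))|].
    destruct (vertex_upper y (S j) i ltac:(lia)) as [_ U]. rewrite S_INR in U.
    eapply Rle_trans; [|apply Rle_abs]. lra.
Qed.

(** Points with the same base and generator lie within one unit of the path: leaving a vertex by the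
    edge just used to reach it would revisit a vertex, against [vert_inj]. *)
Lemma same_edge c y s t :
  infix_bounded c y -> 0 <= s <= INR (length y) -> 0 <= t <= INR (length y) ->
  pbase (path_pt y s) = pbase (path_pt y t) -> pgen (path_pt y s) = pgen (path_pt y t) ->
  Rabs (s - t) = Rabs (palpha (path_pt y s) - palpha (path_pt y t)).
Proof.
  intros B Hs Ht.
  destruct (path_pt_base y s Hs) as (i & a & al & -> & Hal & Hi & C).
  destruct (path_pt_base y t Ht) as (j & a' & be & -> & Hbe & Hj & C'). simpl.
  intros E <-. apply (vert_inj c y i j B Hi Hj) in E. subst j.
  assert (N : forall k, (S i <= length y)%nat -> i = S k ->
     comp (vert y i) (fgen a) = vert y (S i) -> comp (vert y i) (fgen a) = vert y k -> False).
  { intros k H1 H2 E1 E2. rewrite E1 in E2. apply (vert_inj c y) in E2; [lia|exact B|lia|lia]. }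
  destruct C as [(-> & C1 & C2)|[(-> & k & C1 & C2)|(-> & ->)]],
    C' as [(-> & C1' & C2')|[(-> & k' & C1' & C2')|(-> & ->)]];
  try (exfalso; eauto; fail);
  unfold Rabs; repeat destruct (Rcase_abs _); lra.
Qed.

Lemma infix_bounded_quasigeodesic c y :
  (1 <= c)%nat -> infix_bounded c y -> quasigeodesic (INR c) 0 y.
Proof.
  intros Hc B s t Hs Ht.
  assert (Hc' : 1 <= INR c) by (apply (le_INR 1) in Hc; exact Hc).
  pose proof (Rabs_pos (s - t)). split.
  - rewrite Rminus_0_r. apply gdist_ge.
    + intros h k d e H1 H2. apply (near_lower c y s t); auto; apply path_pt_near; assumption.
    + intros E1 E2. rewrite <- (same_edge c y s t B Hs Ht E1 E2).
      rewrite <- (Rmult_1_l (Rabs (s - t))) at 2. apply Rmult_le_compat_r; [assumption|].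
      apply (Rmult_le_reg_l (INR c)); [lra|]. field_simplify; lra.
  - rewrite Rplus_0_r. eapply Rle_trans; [apply path_pt_upper; assumption|].
    rewrite <- (Rmult_1_l (Rabs (s - t))) at 1. apply Rmult_le_compat_r; assumption.
Qed.

Theorem theorem3p6 :
  forall (u : word) (Tm Tp : tree),
    ncarets Tm = ncarets Tp ->
    reduced Tm Tp ->
    diagram_fun Tm Tp = eval u ->
    quasigeodesic 6 0 (eta Tm Tp).
Proof.
  intros u Tm Tp _ Red _.
  replace 6 with (INR 6) by (simpl; lra).
  apply infix_bounded_quasigeodesic; [lia|].
  intros p v q u' E H. exact (eta_infix_bound Tm Tp p v q u' Red E H).
Qed.
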